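(* Every simple unweighted graph $G = (V, E)$ with $G \notin \{K_2, \bar{K}_2, K_3, \bar{K}_3\}$ can be recovered (i.e., its edge set determined) from cut comparison queries, using $O(\min\{(|E| + |V|)\log |V|, |V|^2\})$ cut comparison queries and $\widetilde{O}(|V|^2)$ time.
   Context: For $S \subseteq V$, $\partial(S)$ denotes the set of edges with exactly one endpoint in $S$. A cut comparison query takes two sets $S, T$ with $\emptyset \neq S, T \subsetneq V$ and reveals whether $|\partial(S)| <, =, >$ $|\partial(T)|$. $K_m$ is the complete graph on $m$ vertices and $\bar{K}_m$ is its complement (the empty graph on $m$ vertices). The vertex set $V$ is known; the edge set is unknown. *)

(* Defs.v *)
From mathcomp Require Import all_boot.
Set Implicit Arguments.
Unset Strict Implicit.
Unset Printing Implicit Defensive.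

(** * Graphs and cuts *)

(* The known vertex set is 'I_n; a graph on it is given by its edge set E. *)
Definition simple_graph (n : nat) (E : {set {set 'I_n}}) : Prop :=
  forall e : {set 'I_n}, e \in E -> #|e| = 2.

Definition complete_graph (n : nat) : {set {set 'I_n}} :=
  [set e : {set 'I_n} | #|e| == 2].

Definition empty_graph (n : nat) : {set {set 'I_n}} := set0.

(* E is one of K_2, its complement, K_3, its complement. *)
Definition exceptional (n : nat) (E : {set {set 'I_n}}) : Prop :=
  (n = 2 \/ n = 3) /\ (E = complete_graph n \/ E = empty_graph n).

Definition cut (n : nat) (E : {set {set 'I_n}}) (S : {set 'I_n}) :
    {set {set 'I_n}} :=
  [set e in E | #|e :&: S| == 1].

Definition proper_side (n : nat) (S : {set 'I_n}) : Prop :=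
  S <> set0 /\ S <> [set: 'I_n].

Definition cut_oracle (n : nat) (E : {set {set 'I_n}}) (S T : {set 'I_n}) :
    comparison :=
  if #|cut E S| < #|cut E T| then Lt
  else if #|cut E S| == #|cut E T| then Eq
  else Gt.

(** * Oracle RAM programs with logarithmic cost *)

(* A program mentions finitely many registers and finitely many arrays, both
   named by numerals fixed in the program text; only array indices are
   computed at run time. *)

Inductive binop := OpAdd | OpSub | OpMul | OpDiv.

Inductive expr :=
| Num of nat
| Reg of nat
| Arr of nat & expr
| Bin of binop & expr & expr.

Inductive cmd :=
| Skip
| Assign of nat & expr           (* register := expr *)
| Store of nat & expr & expr     (* array[expr] := expr *)
| Seqc of cmd & cmd
| Ifc of expr & cmd & cmd        (* nonzero means true *)
| While of expr & cmd
| Query of nat.                  (* register := answer of the oracle *)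

Record state := State { reg : nat -> nat; arr : nat -> nat -> nat }.

Definition upd (T : Type) (f : nat -> T) (x : nat) (v : T) : nat -> T :=
  fun y => if y == x then v else f y.

Definition set_reg (s : state) (r v : nat) : state :=
  State (upd (reg s) r v) (arr s).

Definition set_arr (s : state) (a i v : nat) : state :=
  State (reg s) (upd (arr s) a (upd (arr s a) i v)).

(* Subtraction is truncated and division by 0 gives 0. *)
Definition eval_op (o : binop) (x y : nat) : nat :=
  match o with
  | OpAdd => x + y
  | OpSub => x - y
  | OpMul => x * y
  | OpDiv => x %/ y
  end.

Fixpoint eval (s : state) (e : expr) : nat :=
  match e with
  | Num k => k
  | Reg r => reg s r
  | Arr a e1 => arr s a (eval s e1)
  | Bin o e1 e2 => eval_op o (eval s e1) (eval s e2)
  end.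

Definition bitlen (x : nat) : nat := (trunc_log 2 x).+1.

(* Every value produced during evaluation is charged its bit length, so that
   unit-cost arithmetic on huge numbers cannot be exploited. *)
Fixpoint ecost (s : state) (e : expr) : nat :=
  bitlen (eval s e) +
  match e with
  | Num _ | Reg _ => 0
  | Arr _ e1 => ecost s e1
  | Bin _ e1 e2 => ecost s e1 + ecost s e2
  end.

(* The two sides of a query are the sets whose characteristic vectors are
   stored in arrays 0 and 1. They persist between queries: a query takes one
   time unit, whereas every change to the two sets is paid for by stores. *)
Definition arr_set (n : nat) (s : state) (a : nat) : {set 'I_n} :=
  [set i : 'I_n | arr s a i != 0].

Definition answer (c : comparison) : nat :=
  match c with Lt => 0 | Eq => 1 | Gt => 2 end.

(* [exec O p s s' q t]: with oracle O, program p started in s halts in s'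
   after q queries and t time units. There is no rule for a query with a side
   that is empty or everything, so programs may not make one. *)
Inductive exec (n : nat) (O : {set 'I_n} -> {set 'I_n} -> comparison) :
    cmd -> state -> state -> nat -> nat -> Prop :=
| exec_skip s :
    exec O Skip s s 0 1
| exec_assign s r e :
    exec O (Assign r e) s (set_reg s r (eval s e)) 0 (1 + ecost s e)
| exec_store s a i e :
    exec O (Store a i e) s (set_arr s a (eval s i) (eval s e))
      0 (1 + ecost s i + ecost s e)
| exec_seq p1 p2 s s1 s2 q1 q2 t1 t2 :
    exec O p1 s s1 q1 t1 -> exec O p2 s1 s2 q2 t2 ->
    exec O (Seqc p1 p2) s s2 (q1 + q2) (t1 + t2)
| exec_if_true e p1 p2 s s' q t :
    eval s e <> 0 -> exec O p1 s s' q t ->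
    exec O (Ifc e p1 p2) s s' q (1 + ecost s e + t)
| exec_if_false e p1 p2 s s' q t :
    eval s e = 0 -> exec O p2 s s' q t ->
    exec O (Ifc e p1 p2) s s' q (1 + ecost s e + t)
| exec_while_true e p s s1 s2 q1 q2 t1 t2 :
    eval s e <> 0 -> exec O p s s1 q1 t1 -> exec O (While e p) s1 s2 q2 t2 ->
    exec O (While e p) s s2 (q1 + q2) (1 + ecost s e + t1 + t2)
| exec_while_false e p s :
    eval s e = 0 ->
    exec O (While e p) s s 0 (1 + ecost s e)
| exec_query s r :
    proper_side (arr_set n s 0) -> proper_side (arr_set n s 1) ->
    exec O (Query r) s
      (set_reg s r (answer (O (arr_set n s 0) (arr_set n s 1)))) 1 1.

(* The only input is the number of vertices, in register 0. *)
Definition init_state (n : nat) : state :=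
  State (upd (fun _ => 0) 0 n) (fun _ _ => 0).

(* The output is the n * n adjacency matrix, row by row, in array 2. *)
Definition outputs (n : nat) (s : state) (E : {set {set 'I_n}}) : Prop :=
  forall i j : 'I_n, arr s 2 (i * n + j) = ([set i; j] \in E).

(* Main.v *)
Require Import Defs.
From mathcomp Require Import all_boot zify.
Set Implicit Arguments.
Unset Strict Implicit.
Unset Printing Implicit Defensive.

(** For a vertex [v] outside [A], comparing the cuts of [A + v] and [A] tells the
    sign of [d(v) - 2 e(v, A)], where [e(v, A)] counts the neighbours of [v] in
    [A]. Let [A] grow through the initial segments of the vertices other than
    [v], from the first vertex alone to everything but the last one. If the sign
    is the same at both ends, [v] has at most two neighbours, all among these two
    vertices, and one more comparison settles the row. Otherwise bisection finds
    a vertex [m] whose addition to the segment [B] below it changes the sign.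
    Then [m] is a neighbour of [v], and adding any set [W] avoiding [m] to [B]
    changes the sign if and only if [W] contains a new neighbour. By
    complementation the same holds for the segment above [m]. Each neighbour is
    then located by galloping: blocks of doubling length until one is hit,
    followed by bisection of that block. This costs O(1 + log g) queries for a
    gap [g], hence O(min (n, (d(v) + 1) log n)) for the whole row. *)

(** * Weakest preconditions with costs *)

(** Only registers are kept below a fixed bound [U], so values are controlled only for such
    expressions. *)
Fixpoint reads_no_array (e : expr) : bool :=
  match e with
  | Defs.Num _ | Reg _ => true
  | Arr _ _ => false
  | Bin _ a b => reads_no_array a && reads_no_array b
  end.

(** Exponent of [U] bounding the value when the registers are at most [U >= 2]. A numeral [k] counts
    [k.+1]: generous, but positive, as bounding a sum by a product of powers requires. *)
Fixpoint degree (e : expr) : nat :=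
  match e with
  | Defs.Num k => k.+1
  | Reg _ => 1
  | Arr _ e1 => degree e1
  | Bin _ a b => degree a + degree b
  end.

(** Each subexpression is charged its own bit length, hence its own degree. *)
Fixpoint weight (e : expr) : nat :=
  degree e +
  match e with
  | Defs.Num _ | Reg _ => 0
  | Arr _ e1 => weight e1
  | Bin _ a b => weight a + weight b
  end.

Fixpoint cmd_weight (p : cmd) : nat :=
  match p with
  | Skip | Query _ => 1
  | Assign _ e => 1 + weight e
  | Store _ i e => 1 + weight i + weight e
  | Seqc a b => cmd_weight a + cmd_weight b
  | Ifc e a b => 1 + weight e + (cmd_weight a + cmd_weight b)
  | While e a => 1 + weight e + cmd_weight a
  end.

Definition regs_le (U : nat) (s : state) := forall r, reg s r <= U.

Lemma degree_gt0 e : 0 < degree e.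
Proof. by elim: e => //= [_ a IHa b _]; rewrite addn_gt0 IHa. Qed.

Lemma leq_addn_expn U a b : 1 < U -> 0 < a -> 0 < b -> U ^ a + U ^ b <= U ^ (a + b).
Proof.
move=> U1 a0 b0; rewrite expnD.
have : U ^ 1 <= U ^ a by rewrite leq_exp2l.
have : U ^ 1 <= U ^ b by rewrite leq_exp2l.
rewrite expn1; move: (U ^ a) (U ^ b) => x y; nia.
Qed.

Lemma eval_leq_expn U s e :
  1 < U -> regs_le U s -> reads_no_array e -> eval s e <= U ^ degree e.
Proof.
move=> U1 sU; elim: e => //= [k _|o a IHa b IHb /andP[/IHa lea /IHb leb]].
  by apply: leq_trans (ltnW (ltn_expl k U1)) _; rewrite leq_exp2l.
have leD := leq_addn_expn U1 (degree_gt0 a) (degree_gt0 b).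
case: o => /=.
- exact: leq_trans (leq_add lea leb) leD.
- by apply: leq_trans (leq_subr _ _) _; apply: leq_trans leD; apply: leq_trans lea (leq_addr _ _).
- by rewrite expnD leq_mul.
- by apply: leq_trans (leq_div _ _) _; apply: leq_trans leD; apply: leq_trans lea (leq_addr _ _).
Qed.

Lemma bitlen_leq x k : 0 < k -> x < 2 ^ k -> bitlen x <= k.
Proof.
move=> k0 xk; rewrite /bitlen; case: x xk => [|x] xk; first by rewrite trunc_log0.
rewrite -(@ltn_exp2l 2) //; apply: leq_ltn_trans xk; exact: trunc_logP.
Qed.

Lemma bitlen_expn U x k : 0 < k -> x <= U ^ k -> bitlen x <= k * bitlen U.
Proof.
move=> k0 xU; apply: bitlen_leq; first by rewrite muln_gt0 k0.
apply: leq_ltn_trans xU _; rewrite mulnC expnM ltn_exp2r //; exact: trunc_log_ltn.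
Qed.

Lemma ecost_leq U s e :
  1 < U -> regs_le U s -> reads_no_array e -> ecost s e <= weight e * bitlen U.
Proof.
move=> U1 sU ne.
have ev e' : reads_no_array e' -> bitlen (eval s e') <= degree e' * bitlen U.
  by move=> ne'; apply: bitlen_expn (degree_gt0 _) _; apply: eval_leq_expn.
elim: e ne => //= [k _|r _|o a IHa b IHb nab].
- by rewrite !addn0; exact: (ev (Defs.Num k)).
- by rewrite !addn0; exact: (ev (Reg r)).
have /= h := ev (Bin o a b) nab; case/andP: nab => /IHa ha /IHb hb.
by rewrite mulnDl leq_add // mulnDl leq_add.
Qed.

Section Triples.

Variables (n : nat) (O : {set 'I_n} -> {set 'I_n} -> comparison) (U : nat).
Hypothesis U1 : 1 < U.

Implicit Types (p : cmd) (e : expr) (s : state) (Q : state -> nat -> nat -> Prop).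

(* [q] and [k] are the queries and the elementary steps
   made so far. A step costs time at most [cmd_weight p * bitlen U]. *)
Definition wp p Q s q k :=
  regs_le U s ->
  exists s' dq dk t,
    [/\ exec O p s s' dq t, regs_le U s',
        t <= dk * (cmd_weight p * bitlen U) & Q s' (q + dq) (k + dk)].

Lemma wp_conseq p Q Q' s q k :
  wp p Q s q k -> (forall s' q' k', Q s' q' k' -> Q' s' q' k') -> wp p Q' s q k.
Proof.
by move=> H QQ' /H[s' [dq [dk [t [? ? ? /QQ' ?]]]]]; exists s', dq, dk, t.
Qed.

Lemma wp_regs p Q s q k : (regs_le U s -> wp p Q s q k) -> wp p Q s q k.
Proof. by move=> H sU; apply: H. Qed.

Lemma regs_le_set s r v : regs_le U s -> v <= U -> regs_le U (set_reg s r v).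
Proof. by move=> sU vU r'; rewrite /= /upd; case: eqP. Qed.

Lemma wp_assign r e Q s q k :
  reads_no_array e -> eval s e <= U -> Q (set_reg s r (eval s e)) q k.+1 ->
  wp (Assign r e) Q s q k.
Proof.
move=> ne eU HQ sU; exists (set_reg s r (eval s e)), 0, 1, (1 + ecost s e).
split; [exact: exec_assign | exact: regs_le_set | | by rewrite addn0 addn1].
by rewrite mul1n /= mulnDl leq_add ?ecost_leq // mul1n.
Qed.

Lemma wp_store a i e Q s q k :
  reads_no_array i -> reads_no_array e ->
  Q (set_arr s a (eval s i) (eval s e)) q k.+1 -> wp (Store a i e) Q s q k.
Proof.
move=> ni ne HQ sU; exists (set_arr s a (eval s i) (eval s e)), 0, 1.
exists (1 + ecost s i + ecost s e).
split; [exact: exec_store | by [] | | by rewrite addn0 addn1].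
by rewrite mul1n /= !mulnDl !leq_add ?ecost_leq // mul1n.
Qed.

Lemma wp_seq p1 p2 Q s q k : wp p1 (wp p2 Q) s q k -> wp (Seqc p1 p2) Q s q k.
Proof.
move=> H /H[s1 [q1 [k1 [t1 [e1 U1' le1 H2]]]]].
have [s2 [q2 [k2 [t2 [e2 U2 le2 HQ]]]]] := H2 U1'.
exists s2, (q1 + q2), (k1 + k2), (t1 + t2); split=> //; last by rewrite !addnA.
  exact: exec_seq e1 e2.
rewrite mulnDl /=; apply: leq_add.
  by apply: leq_trans le1 _; rewrite leq_mul // leq_mul // leq_addr.
by apply: leq_trans le2 _; rewrite leq_mul // leq_mul // leq_addl.
Qed.

Lemma wp_if e p1 p2 Q s q k :
  reads_no_array e ->
  (eval s e <> 0 -> wp p1 Q s q k.+1) -> (eval s e = 0 -> wp p2 Q s q k.+1) ->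
  wp (Ifc e p1 p2) Q s q k.
Proof.
move=> ne H1 H2 sU.
have cost w t dk : t <= dk * (w * bitlen U) -> w <= cmd_weight p1 + cmd_weight p2 ->
    1 + ecost s e + t <= dk.+1 * (cmd_weight (Ifc e p1 p2) * bitlen U).
  move=> le1 lew; rewrite mulSn leq_add //=.
    rewrite mulnDl; apply: leq_trans (leq_addr _ _).
    by rewrite mulnDl leq_add ?ecost_leq // mul1n.
  apply: leq_trans le1 _; rewrite leq_mul // leq_mul //.
  exact: leq_trans lew (leq_addl _ _).
case: (eqVneq (eval s e) 0) => [e0|/eqP e0].
  have [s' [dq [dk [t [ex sU' le1 HQ]]]]] := H2 e0 sU.
  exists s', dq, dk.+1, (1 + ecost s e + t); split=> //.
  - exact: exec_if_false.
  - exact: cost le1 (leq_addl _ _).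
  - by rewrite addnS -addSn.
have [s' [dq [dk [t [ex sU' le1 HQ]]]]] := H1 e0 sU.
exists s', dq, dk.+1, (1 + ecost s e + t); split=> //.
- exact: exec_if_true.
- exact: cost le1 (leq_addr _ _).
- by rewrite addnS -addSn.
Qed.

(** [N] is a variant: its strict decrease gives termination by strong induction. Each evaluation of
    the guard counts as one step. *)
Lemma wp_while e p (I : nat -> state -> nat -> nat -> Prop) Q N s q k :
  reads_no_array e -> I N s q k ->
  (forall N s q k, I N s q k -> eval s e <> 0 ->
    wp p (fun s' q' k' => exists2 N', N' < N & I N' s' q' k') s q k.+1) ->
  (forall N s q k, I N s q k -> eval s e = 0 -> Q s q k.+1) ->
  wp (While e p) Q s q k.
Proof.
move=> ne Hs Hbody Hend; elim/ltn_ind: N => N IH in s q k Hs *.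
move=> sU; set c := cmd_weight (While e p) * bitlen U.
have ce : 1 + ecost s e <= c.
  rewrite /c /= mulnDl; apply: leq_trans (leq_addr _ _).
  by rewrite mulnDl leq_add ?ecost_leq // mul1n.
case: (eqVneq (eval s e) 0) => [e0|/eqP e0].
  exists s, 0, 1, (1 + ecost s e); split=> //; first exact: exec_while_false.
    by rewrite mul1n.
  by rewrite addn0 addn1; apply: Hend Hs e0.
have [s1 [q1 [k1 [t1 [ex1 sU1 le1 [N' ltN H1]]]]]] := Hbody _ _ _ _ Hs e0 sU.
have [s2 [q2 [k2 [t2 [ex2 sU2 le2 HQ]]]]] := IH N' ltN _ _ _ H1 sU1.
exists s2, (q1 + q2), (k1 + k2).+1, (1 + ecost s e + t1 + t2); split=> //.
- exact: exec_while_true ex1 ex2.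
- rewrite mulSn mulnDl -addnA leq_add // leq_add //.
  by apply: leq_trans le1 _; rewrite leq_mul // leq_mul // leq_addl.
- by rewrite addnS !addnA -2!addSn.
Qed.

Lemma wp_query r Q s q k :
  proper_side (arr_set n s 0) -> proper_side (arr_set n s 1) ->
  Q (set_reg s r (answer (O (arr_set n s 0) (arr_set n s 1)))) q.+1 k.+1 ->
  wp (Query r) Q s q k.
Proof.
move=> p0 p1 HQ sU; eexists _, 1, 1, 1; split; first exact: exec_query.
- by apply: regs_le_set => //; apply: leq_trans U1; case: (O _ _).
- by rewrite !mul1n.
- by rewrite !addn1.
Qed.

End Triples.

(** * Counting neighbours *)

Definition count_in (n : nat) (N A : nat -> bool) : nat := \sum_(i < n) (A i && N i).

Lemma leq_count_in n (N A B : nat -> bool) :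
  (forall i, i < n -> N i -> A i -> B i) -> count_in n N A <= count_in n N B.
Proof.
move=> AB; apply: leq_sum => i _.
have := AB i (ltn_ord i); case: (N i); rewrite ?andbF // !andbT.
by case: (A i) => // ->.
Qed.

Lemma eq_count_in n (N A B : nat -> bool) :
  (forall i, i < n -> N i -> A i = B i) -> count_in n N A = count_in n N B.
Proof.
by move=> AB; apply/eqP; rewrite eqn_leq !leq_count_in // => i lt_in Ni; rewrite AB.
Qed.

Lemma count_in_add1 n (N A : nat -> bool) m :
  m < n -> A m = false ->
  count_in n N (fun i => A i || (i == m)) = count_in n N A + N m.
Proof.
move=> mn Am; rewrite /count_in (bigD1 (Ordinal mn)) //= [in RHS](bigD1 (Ordinal mn)) //=.
rewrite Am eqxx /= add0n addnC; congr (_ + _); apply: eq_bigr => i ne.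
by rewrite (_ : (i == m :> nat) = false) ?orbF //; apply/negbTE.
Qed.

Lemma count_in0 n (N : nat -> bool) : count_in n N (fun=> false) = 0.
Proof. by rewrite /count_in big1. Qed.

Lemma count_in1 n (N : nat -> bool) m : m < n -> count_in n N (eq_op^~ m) = N m.
Proof. by move=> mn; have := @count_in_add1 n N (fun=> false) m mn erefl; rewrite count_in0. Qed.

Lemma count_inC n (N A : nat -> bool) :
  count_in n N A + count_in n N (fun i => ~~ A i) = count_in n N (fun=> true).
Proof.
by rewrite /count_in -big_split; apply: eq_bigr => i _ /=; case: (A i); rewrite ?addn0.
Qed.

(* The answer comparing [A + v] with [A], when [v] has degree [d] and [e]
   neighbours in [A]: the two cuts differ by [d - 2 * e]. *)
Definition half_test (d e : nat) : nat :=
  if d < 2 * e then 0 else if d == 2 * e then 1 else 2.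

Lemma half_test_le2 d e : half_test d e <= 2.
Proof. by rewrite /half_test; case: ifP => //; case: ifP. Qed.

(** [half_test d] is nonincreasing, so once it drops right after [e] it never returns to its value
    at [e]. *)
Lemma half_test_ltn d e e' :
  half_test d e <> half_test d e.+1 -> e < e' -> half_test d e' != half_test d e.
Proof. by rewrite /half_test; do ![case: ifP => ?]; lia. Qed.

(** Replacing [e] by [d - e] flips the sign of [d - 2 * e], which exchanges the codes 0 and 2. *)
Lemma half_test_compl d e : e <= d -> half_test d (d - e) = 2 - half_test d e.
Proof. by rewrite /half_test; do ![case: ifP => ?]; lia. Qed.

(** The emptiness test behind the galloping search. Without a new neighbour the two counts agree;
    with one, the count grows by at least one and the answer has already dropped. *)
Lemma half_test_block n d (N A B : nat -> bool) :
  (forall i, i < n -> B i -> A i) ->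
  half_test d (count_in n N B) <> half_test d (count_in n N B).+1 ->
  (half_test d (count_in n N A) != half_test d (count_in n N B)) <->
  (exists2 i, i < n & [&& A i, ~~ B i & N i]).
Proof.
move=> BA ne; split=> [|[i lt_in /and3P[Ai /negbTE Bi Ni]]]; last first.
  have : count_in n N (fun j => B j || (j == i)) <= count_in n N A.
    by apply: leq_count_in => j lt_jn _ /orP[/BA->|/eqP->].
  by rewrite count_in_add1 // Ni addn1; apply: half_test_ltn.
case: (boolP [exists i : 'I_n, [&& A i, ~~ B i & N i]]) => [/existsP[i Hi] _|].
  by exists (val i); [exact: ltn_ord | exact: Hi].
rewrite negb_exists => /forallP none; suff -> : count_in n N A = count_in n N B by rewrite eqxx.
apply: eq_count_in => i lt_in Ni; have := none (Ordinal lt_in).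
rewrite /= Ni andbT negb_and negbK; case Bi: (B i); first by rewrite (BA i).
by rewrite orbF => /negbTE.
Qed.

(** * The program *)

Notation "a +' b" := (Bin OpAdd a b) (at level 50, left associativity).
Notation "a -' b" := (Bin OpSub a b) (at level 50, left associativity).
Notation "a *' b" := (Bin OpMul a b) (at level 40, left associativity).
Notation "a /' b" := (Bin OpDiv a b) (at level 40, left associativity).
Notation "'<{' a ; .. ; b ; c '}>'" := (Seqc a .. (Seqc b c) ..).
Notation "r ::= e" := (Assign r e) (at level 70).
Notation "# k" := (Defs.Num k) (at level 9, format "# k").

(* Registers; [rn] is the input and [rv] the vertex whose row is computed. *)
Notation rn := 0. Notation rv := 1. Notation rw := 2. Notation ra := 3.
Notation rr := 4. Notation rlo := 5. Notation rhi := 6. Notation rm := 7.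
Notation rx := 8. Notation rs := 9. Notation rmode := 10. Notation rside := 11.
Notation rz := 12. Notation rg := 13. Notation ry := 14.

(** Since subtraction is truncated, this is the absolute difference, hence also a test for
    inequality. *)
Definition dist_expr (a b : expr) : expr := (a -' b) +' (b -' a).

(* Vanishes at [m] and at [v]; elsewhere nonzero when [rg] is, or when [w] lies
   below [m] ([rside = 0]), resp. above [m] ([rside = 1]). *)
Definition member_expr : expr :=
  (Reg rg +' ((#1 -' Reg rside) *' (Reg rm -' Reg rw)
              +' Reg rside *' (Reg rw -' Reg rm)))
  *' dist_expr (Reg rw) (Reg rm) *' dist_expr (Reg rw) (Reg rv).

(** Only the positions from [rx] up to [rz - 1] are rewritten, so that short blocks are cheap. The
    extra summand for array 0 is 1 exactly at [v]. *)
Definition fill : cmd :=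
  <{ rw ::= Reg rx;
     While (Reg rz -' Reg rw)
       <{ Store 1 (Reg rw) member_expr;
          Store 0 (Reg rw) (member_expr +' (#1 -' dist_expr (Reg rw) (Reg rv)));
          rw ::= Reg rw +' #1 }> }>.

Definition fill_all : cmd := <{ rx ::= #0; rz ::= Reg rn; fill }>.

(** The block is restored after the query, so the time is proportional to its length rather than to
    [n]. *)
Definition test_block : cmd := <{ rg ::= #1; fill; Query rr; rg ::= #0; fill }>.

(** In mode 0 the block of length [rs] at [rx] is tested, and the length doubles after a miss. In
    mode 1 that block is known to be hit and its lower half is tested; a miss leaves the upper half.
    The guard fails when the known block is a single vertex, which is then recorded. [rz] is the end
    of the tested block, capped at [n]. *)
Definition gallop_step : cmd :=
  Ifc ((#1 -' Reg rmode) +' (Reg rs -' #1))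
    <{ ry ::= Reg rs /' (#1 +' Reg rmode);
       rz ::= (Reg rx +' Reg ry) -' ((Reg rx +' Reg ry) -' Reg rn);
       test_block;
       Ifc (dist_expr (Reg ra) (Reg rr))
         <{ rmode ::= #1; rs ::= Reg ry }>
         <{ rx ::= Reg rx +' Reg ry;
            Ifc (Reg rmode) (rs ::= Reg ry) (rs ::= Reg rs *' #2) }> }>
    <{ Store 2 (Reg rv *' Reg rn +' Reg rx) (#1);
       rx ::= Reg rx +' #1; rs ::= #1; rmode ::= #0 }>.

Definition gallop : cmd :=
  <{ rg ::= #0; fill_all; Query ra; rx ::= #0; rs ::= #1; rmode ::= #0;
     While (Reg rn -' Reg rx) gallop_step }>.

Definition bisect : cmd :=
  While (Reg rhi -' Reg rlo -' #1)
    <{ rm ::= (Reg rlo +' Reg rhi) /' #2; fill_all; Query rr;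
       Ifc (dist_expr (Reg ra) (Reg rr)) (rhi ::= Reg rm) (rlo ::= Reg rm) }>.

(* The first, the last and a middle vertex other than [v]; the middle one
   differs from the two others when [n >= 4]. *)
Definition first_expr : expr := #1 -' Reg rv.
Definition last_expr : expr := (Reg rn -' #1) -' (#1 -' ((Reg rn -' #1) -' Reg rv)).
Definition mid_expr : expr := #1 +' (#1 -' (Reg rv -' #1)).

Definition entry (i : expr) : expr := Reg rv *' Reg rn +' i.

(** Galloping from the segment below [m] finds the neighbours above [m]; with [rside = 1] the roles
    are exchanged. *)
Definition dense_row : cmd :=
  <{ bisect; rm ::= Reg rlo; Store 2 (entry (Reg rm)) (#1);
     gallop; rside ::= #1; gallop }>.

(* For [n = 3] there is no middle vertex. The arrays then hold [{first, v}] and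
   [{first}], so clearing [first] in array 0 compares the degree of [v] with that
   of [first]. *)
Definition sparse_row : cmd :=
  <{ Ifc (dist_expr (Reg ra) (#1))
       <{ rlo ::= #1 -' Reg ra; rhi ::= Reg ra /' #2 }>
       <{ Ifc (Reg rn -' #3)
            <{ rm ::= mid_expr; rg ::= #1; fill_all; Query rr; rlo ::= #1 -' Reg rr }>
            <{ Store 0 first_expr (#0); Query rr; rlo ::= Reg rr /' #2 }>;
          rhi ::= Reg rlo }>;
     Store 2 (entry first_expr) (Reg rlo); Store 2 (entry last_expr) (Reg rhi) }>.

Definition row : cmd :=
  <{ rside ::= #0; rg ::= #0;
     rm ::= first_expr +' #1; fill_all; Query ra; rlo ::= Reg rm;
     rm ::= last_expr; fill_all; Query rr; rhi ::= Reg rm;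
     Ifc (dist_expr (Reg ra) (Reg rr)) dense_row sparse_row }>.

Definition same_regs (l : seq nat) (s s' : state) :=
  forall r, r \notin l -> reg s' r = reg s r.

Definition holds_at (v : nat) (s : state) (A : nat -> bool) (i : nat) : Prop :=
  (arr s 1 i != 0) = A i /\ (arr s 0 i != 0) = A i || (i == v).

Definition holds (n v : nat) (s : state) (A : nat -> bool) : Prop :=
  forall i, i < n -> holds_at v s A i.

Definition side_set (v m : nat) (side g : bool) (i : nat) : bool :=
  [&& i != m, i != v & g || (if side then m < i else i < m)].

(** The zeros of the new row are inherited, so this describes a full row only where [f] vanishes
    beforehand. *)
Definition row_upd (off : nat) (P : nat -> bool) (f g : nat -> nat) : Prop :=
  forall j, g j = if (off <= j) && P (j - off) then 1 else f j.

Lemma upd_neq (T : Type) (f : nat -> T) x y a : y != x -> upd f x a y = f y.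
Proof. by rewrite /upd => /negbTE->. Qed.

Lemma eval_member s (side g : bool) :
  reg s rside = side -> reg s rg = g ->
  (eval s member_expr != 0) = side_set (reg s rv) (reg s rm) side g (reg s rw).
Proof.
move=> /= -> ->; rewrite /side_set; case: side; case: g => /=;
  rewrite !muln_eq0 ?mul0n ?mul1n ?addn0 ?add0n; lia.
Qed.

(** * Recovering one row of the adjacency matrix *)

Section Row.

Variables (n : nat) (O : {set 'I_n} -> {set 'I_n} -> comparison) (U : nat).
Hypothesis n3 : 2 < n.
Hypothesis nU : 4 * n <= U.
Variables (v : nat) (N : nat -> bool).
Hypothesis vn : v < n.
Hypothesis Nv : N v = false.
Hypothesis N_lt : forall i, N i -> i < n.

Notation e := (count_in n N).
Notation d := (count_in n N (fun=> true)).
Notation L := (trunc_log 2 n).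
Notation wpU := (wp O U).

Hypothesis O_half : forall s A, holds n v s A -> A v = false ->
  answer (O (arr_set n s 0) (arr_set n s 1)) = half_test d (e A).

Lemma U_gt1 : 1 < U. Proof. lia. Qed.
Let U1 := U_gt1.

(** The hypothesis on [A] is the loop invariant before the first pass. A pass takes four steps:
    guard, two stores, increment. The first assignment and the last guard account for the other
    two. *)
Lemma wp_fill (Q : state -> nat -> nat -> Prop) s q k (side g : bool) A :
  reg s rv = v -> reg s rside = side -> reg s rg = g -> reg s rz <= n ->
  (forall i, i < n -> if reg s rx <= i < reg s rz
     then A i = side_set v (reg s rm) side g i else holds_at v s A i) ->
  (forall s', same_regs [:: rw] s s' -> arr s' 2 = arr s 2 -> holds n v s' A ->
     Q s' q (k + 4 * (reg s rz - reg s rx) + 2)) ->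
  wpU fill Q s q k.
Proof.
move=> sv sside sg zn sA HQ; apply: wp_regs => sU.
apply: wp_seq; apply: (wp_assign _ U1) => //=.
set s1 := set_reg _ _ _.
pose I M s' q' k' := [/\ same_regs [:: rw] s s', arr s' 2 = arr s 2, q' = q,
  [/\ reg s' rw = reg s rx + (reg s rz - reg s rx - M), M <= reg s rz - reg s rx
    & k' = k.+1 + 4 * (reg s rz - reg s rx - M)] &
  forall i, i < n -> if reg s' rw <= i < reg s rz
     then A i = side_set v (reg s rm) side g i else holds_at v s' A i].
apply: (@wp_while n O U U1 _ _ I _ (reg s rz - reg s rx)) => //.
- split=> //.
  + by move=> r; rewrite !inE /= /upd => /negbTE->.
  + by rewrite /s1 /= /upd /= subnn addn0 muln0 addn0.
- move=> M {}s1 q1 k1 [fr a2 -> [w1 leM ->] H] /=; rewrite (fr rz) //= => ltw.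
  have sg1 : (eval s1 member_expr != 0) = side_set v (reg s rm) side g (reg s1 rw).
    by rewrite (@eval_member s1 side g) ?(fr rside) ?(fr rg) ?(fr rv) ?(fr rm) ?sv.
  apply: wp_seq; apply: (wp_store _ U1) => //=.
  apply: wp_seq; apply: (wp_store _ U1) => //=.
  apply: (wp_assign _ U1) => //=; first by lia.
  exists (M.-1); first by lia.
  split=> //=.
  + by move=> r rw'; rewrite /= /upd; move: (rw'); rewrite inE => /negbTE->; apply: fr.
  + by split; rewrite /= /upd /=; lia.
  move=> i lt_in; have := H i lt_in; rewrite [upd _ _ _ rw]/upd /=.
  case: (ltngtP i (reg s1 rw)) => [lt_iw|gt_iw|eq_iw].
  + rewrite addn1 [reg s1 rw < _]ltnNge (ltnW lt_iw) /=.
    by rewrite /holds_at /= /upd /= (ltn_eqF lt_iw).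
  + rewrite addn1 gt_iw /=; case: ifP => // _.
    by rewrite /holds_at /= /upd /= (gtn_eqF gt_iw).
  + rewrite eq_iw addn1 ltnn /= (_ : reg s1 rw < reg s rz); last by lia.
    move=> Aw; rewrite /holds_at /= /upd /= eqxx.
    move: sg1; rewrite -Aw /= => <-; split=> //.
    by rewrite (fr rv) // sv; clear; lia.
- move=> M {}s1 q1 k1 [fr a2 -> [w1 leM ->] H] /=; rewrite (fr rz) //= => lew.
  rewrite (_ : _.+1 = k + 4 * (reg s rz - reg s rx) + 2); last by lia.
  apply: HQ => // i lt_in; have := H i lt_in; rewrite ifF //; lia.
Qed.

(** Both sides are proper: array 0 contains [v] and omits [j], while array 1 contains [i] and omits
    [v]. *)
Lemma wp_ask (Q : state -> nat -> nat -> Prop) r s q k A :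
  holds n v s A -> A v = false ->
  (exists2 i, i < n & A i) -> (exists2 i, i < n & ~~ A i && (i != v)) ->
  Q (set_reg s r (half_test d (e A))) q.+1 k.+1 -> wpU (Query r) Q s q k.
Proof.
move=> sA Av [i lt_in Ai] [j lt_jn /andP[Aj jv]] HQ.
apply: (wp_query U1); last by rewrite (O_half sA Av).
- split=> [/setP/(_ (Ordinal vn))|/setP/(_ (Ordinal lt_jn))]; rewrite !inE /=.
    by rewrite (sA v vn).2 eqxx orbT.
  by rewrite (sA j lt_jn).2 (negbTE Aj) (negbTE jv).
- split=> [/setP/(_ (Ordinal lt_in))|/setP/(_ (Ordinal vn))]; rewrite !inE /=.
    by rewrite (sA i lt_in).1 Ai.
  by rewrite (sA v vn).1 Av.
Qed.

Lemma wp_fill_all (Q : state -> nat -> nat -> Prop) s q k (side g : bool) :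
  reg s rn = n -> reg s rv = v -> reg s rside = side -> reg s rg = g ->
  (forall s', same_regs [:: rw; rx; rz] s s' -> arr s' 2 = arr s 2 ->
     holds n v s' (side_set v (reg s rm) side g) -> Q s' q (k + 4 * n + 4)) ->
  wpU fill_all Q s q k.
Proof.
move=> sn sv sside sg HQ.
apply: wp_seq; apply: (wp_assign _ U1) => //=.
apply: wp_seq; apply: (wp_assign _ U1) => //=; first by rewrite /upd /= sn; lia.
apply: (@wp_fill _ _ _ _ side g (side_set v (reg s rm) side g)) => //=.
- by rewrite /upd /= sn.
- by move=> i lt_in; rewrite /upd /= sn lt_in.
move=> s' fr a2 sA.
rewrite /upd /= sn (_ : _ + 2 = k + 4 * n + 4); last by lia.
apply: HQ => // r; rewrite !inE !negb_or => /and3P[r2 r8 r12].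
by rewrite fr ?inE //= /upd /= (negbTE r8) (negbTE r12).
Qed.

(** * Galloping search on one side of the pivot *)

Section Gallop.

Variables (side : bool) (m i0 : nat).
Let B := side_set v m side false.
Hypothesis mn : m < n.
Hypothesis mv : m != v.
Hypothesis i0n : i0 < n.
Hypothesis Bi0 : B i0.
Hypothesis pivot : half_test d (e B) <> half_test d (e B).+1.

(** As [v] is not its own neighbour, these are the neighbours above [m] when [side = false] and
    those below [m] when [side = true]. *)
Let target i := [&& N i, ~~ B i & i != m].
Notation found x := (count_in n target (fun i => i < x)).

Lemma side_set_v g : side_set v m side g v = false.
Proof. by rewrite /side_set eqxx andbF. Qed.

(* Vertices below [x] are decided and the current block length is [2 ^ l]; when
   [mode] is set, the block starting at [x] is known to contain a target. Of the
   two query bounds, the first yields O(n) and the second O(log n) per target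
   found. The potential [M] pays both for the time and for termination. *)
Definition gallop_inv s0 q0 k0 M s q k : Prop :=
  exists x l (mode : bool),
  [/\ [/\ reg s rx = x, reg s rs = 2 ^ l, reg s rmode = mode & reg s rg = 0],
      [/\ forall r, r < 8 -> r != rw -> r != rr -> reg s r = reg s0 r,
          reg s rside = side, holds n v s B &
          row_upd (v * n) (fun i => target i && (i < x)) (arr s0 2) (arr s 2)],
      [/\ x <= 2 * n, 2 ^ l <= x.+1 &
          mode -> l <= L /\ exists2 i, x <= i < x + 2 ^ l & target i],
      [/\ q + l <= q0 + 2 * x + mode &
          q <= q0 + found x * (2 * L + 2) + (if mode then 2 * L + 1 - l else l)] &
      M + 3 * x = 6 * n + (if mode then 1 else 2) * 2 ^ l /\
      k + 24 * M <= k0 + 24 * (6 * n + 2)].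

(** This is [half_test_block] for the base set and its union with the block. Two fills and three
    further commands give [8 * y + 7]. *)
Lemma block_test s q k x y (Q : state -> nat -> nat -> Prop) :
  reg s rn = n -> reg s rv = v -> reg s rm = m -> reg s rside = side ->
  reg s ra = half_test d (e B) ->
  reg s rx = x -> reg s rz = minn (x + y) n -> holds n v s B -> 0 < y ->
  (forall s' (b : bool), same_regs [:: rw; rr; rg] s s' -> arr s' 2 = arr s 2 ->
     reg s' rg = 0 -> holds n v s' B ->
     (half_test d (e B) != reg s' rr) = b ->
     (b <-> exists2 i, x <= i < x + y & target i) ->
     forall k', k' <= k + 8 * y + 7 -> Q s' q.+1 k') ->
  wpU test_block Q s q k.
Proof.
move=> sn sv sm sside sa sx sz sB y0 HQ.
(* Leaving out [m] keeps [A + v] proper. Neither [m] nor [v] is a target, so none is lost. *)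
pose A i := B i || [&& x <= i < x + y, i != m & i != v].
have Bv : B v = false by apply: side_set_v.
have Bm : B m = false by rewrite /B /side_set eqxx.
have Av : A v = false by rewrite /A Bv eqxx !andbF.
apply: wp_seq; apply: (wp_assign _ U1) => //=; first by lia.
set s1 := set_reg _ _ _.
apply: wp_seq; apply: (@wp_fill _ s1 _ _ side true A) => //=.
- by rewrite /upd /= sz geq_minr.
- move=> i lt_in; rewrite /upd /= sx sz sm leq_min lt_in andbT /A.
  case: ifP => [/andP[xi xy]|xyF].
    rewrite /B /side_set xi xy /= andbT.
    by case: (i == m); case: (i == v) => //=; rewrite orbT.
  by have [h1 h0] := sB i lt_in; rewrite /holds_at /= h1 h0 xyF /= orbF.
rewrite /upd /= => s2 fr2 a2 s2A.
apply: wp_seq; apply: (@wp_ask _ _ _ _ _ A) => //.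
- by exists i0 => //; rewrite /A Bi0.
- by exists m => //; rewrite mv andbT /A Bm eqxx !andbF.
apply: wp_seq; apply: (wp_assign _ U1) => //=.
have [z2 x2 sd2] : [/\ reg s2 rz = minn (x + y) n, reg s2 rx = x & reg s2 rside = side].
  by rewrite !fr2.
apply: (@wp_fill _ _ _ _ side false B) => //=.
- by rewrite /upd /= fr2.
- by rewrite /upd /= z2 geq_minr.
- move=> i lt_in; rewrite /upd /= z2 x2 leq_min lt_in andbT fr2 //= /upd /= sm.
  case: ifP => // xyF; have [h1 h0] := s2A i lt_in.
  by rewrite /holds_at /= h1 h0 /A xyF orbF.
rewrite /upd /= z2 x2 => s3 fr3 a3 s3B.
have r3 : reg s3 rr = half_test d (e A) by rewrite fr3.
apply: (HQ s3 (half_test d (e B) != reg s3 rr)) => //.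
- move=> r; rewrite !inE !negb_or => /and3P[r2 r4 r13].
  rewrite fr3 ?inE //= /upd /= (negbTE r4) (negbTE r13) fr2 ?inE //= /upd /=.
  by rewrite (negbTE r13).
- by rewrite a3 /= a2.
- by rewrite fr3.
- rewrite r3 eq_sym (@half_test_block _ _ _ A B) //; last by move=> i _ Bi; rewrite /A Bi.
  split=> [[i lt_in /and3P[Ai nBi Ni]]|[i xi /and3P[Ni nBi im]]].
    move: Ai; rewrite /A (negbTE nBi) /= => /and3P[xi im iv]; exists i => //.
    by rewrite /target Ni nBi.
  exists i; first exact: N_lt.
  rewrite Ni nBi /A xi im /= orbC andbT; apply/orP; left.
  by apply/eqP => iv; rewrite iv Nv in Ni.
- rewrite sx sz; lia.
Qed.

Lemma found_step x y : (forall i, x <= i < x + y -> ~~ target i) ->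
  forall i, target i && (i < x + y) = target i && (i < x).
Proof.
move=> none i; case Ti: (target i) => //=.
have := none i; rewrite Ti; lia.
Qed.

(** The potential drops by [2 ^ l1], the length of the block just tested, which pays for the test at
    rate 24. In the logarithmic query bound, switching to bisection needs [l + 1 <= 2 * L + 1 - l],
    which follows from [2 ^ l <= x + 1 <= n]. *)
Lemma gallop_hit s0 q0 k0 M s q k x l (mode : bool) s' k' :
  gallop_inv s0 q0 k0 M s q k -> reg s rx = x -> reg s rs = 2 ^ l ->
  reg s rmode = mode -> x < n -> (mode -> 0 < l) ->
  let l1 := if mode then l.-1 else l in
  (exists2 i, x <= i < x + 2 ^ l1 & target i) ->
  same_regs [:: rw; rr; rg; ry; rz] s s' -> reg s' rg = 0 ->
  holds n v s' B -> arr s' 2 = arr s 2 -> k' <= k + 8 * 2 ^ l1 + 16 ->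
  exists2 M', M' < M &
    gallop_inv s0 q0 k0 M' (set_reg (set_reg s' rmode 1) rs (2 ^ l1)) q.+1 k'.
Proof.
move=> [x0 [l0 [m0 [[sx s2l sm g0] [frs sside sB ru] [x2n lx _] [q1 q2] [HM Hk]]]]].
rewrite sx sm => <- s2l' Em; have {Em}<- : m0 = mode by case: (m0) (mode) Em => [] [].
move=> xn l_gt0 l1 wit fr' g' s'B a2 lek.
have {s2l' s2l}E : l0 = l by apply/eqP; rewrite -(@eqn_exp2l 2) // -s2l -s2l'.
move: lx q1 q2 HM; rewrite {}E => lx q1 q2 HM.
have lL : l <= L by apply: trunc_log_max => //; lia.
have y0 : 0 < 2 ^ l1 by rewrite expn_gt0.
have y2 : 2 ^ l = (if m0 then 2 else 1) * 2 ^ l1.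
  rewrite /l1; case: (m0) l_gt0 => [/(_ isT)|_]; last by rewrite mul1n.
  by case: (l) => // l'; rewrite expnS.
have M3 : 2 ^ l1 <= M by case: (m0) y2 HM; lia.
exists (M - 2 ^ l1); first by lia.
exists x0, l1, true; split.
- by split=> //=; rewrite /upd /= fr'.
- split=> //=; last by rewrite a2.
    by move=> r r8 rw rr; rewrite /upd !ifF ?fr' ?frs //; rewrite ?inE; lia.
  by rewrite /upd /= fr'.
- split=> //; first by move: y2; case: (m0); lia.
  by move=> _; split=> //; rewrite /l1; case: (m0); lia.
- by move: q1 q2; rewrite /l1; case: (m0) l_gt0 => [/(_ isT)|_]; lia.
- by move: y2 HM; case: (m0); lia.
Qed.

(** Let [y] be the length tested. While doubling, the potential loses [3 * y] because [x] advances
    and regains [2 * y] from the longer block. While bisecting, it loses [3 * y] and another [y]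
    from the halved block. Hence the factors 1 and 4. *)
Lemma gallop_empty s0 q0 k0 M s q k x l (mode : bool) s' k' :
  gallop_inv s0 q0 k0 M s q k -> reg s rx = x -> reg s rs = 2 ^ l ->
  reg s rmode = mode -> x < n -> (mode -> 0 < l) ->
  let l1 := if mode then l.-1 else l in
  ~ (exists2 i, x <= i < x + 2 ^ l1 & target i) ->
  same_regs [:: rw; rr; rg; ry; rz] s s' -> reg s' rg = 0 ->
  holds n v s' B -> arr s' 2 = arr s 2 -> k' <= k + 8 * 2 ^ l1 + 16 ->
  exists2 M', M' < M &
    gallop_inv s0 q0 k0 M' (set_reg (set_reg s' rx (x + 2 ^ l1)) rs
      (if mode then 2 ^ l1 else 2 ^ l * 2)) q.+1 k'.
Proof.
move=> [x0 [l0 [m0 [[sx s2l sm g0] [frs sside sB ru] [x2n lx wit] [q1 q2] [HM Hk]]]]].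
rewrite sx sm => <- s2l' Em; have {Em}<- : m0 = mode by case: (m0) (mode) Em => [] [].
move=> xn l_gt0 l1 none fr' g' s'B a2 lek.
have {s2l' s2l}E : l0 = l by apply/eqP; rewrite -(@eqn_exp2l 2) // -s2l -s2l'.
move: lx q1 q2 HM wit; rewrite {}E => lx q1 q2 HM wit.
have lL : l <= L by apply: trunc_log_max => //; lia.
have y0 : 0 < 2 ^ l1 by rewrite expn_gt0.
have y2 : 2 ^ l = (if m0 then 2 else 1) * 2 ^ l1.
  rewrite /l1; case: (m0) l_gt0 => [/(_ isT)|_]; last by rewrite mul1n.
  by case: (l) => // l'; rewrite expnS.
have yl : 2 ^ l1 <= 2 ^ l by move: y2; case: (m0); lia.
have step : forall i, target i && (i < x0 + 2 ^ l1) = target i && (i < x0).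
  by apply: found_step => i xi; apply/negP => Ti; apply: none; exists i.
have efound : found (x0 + 2 ^ l1) = found x0.
  by apply: eq_count_in => i _ Ti; have := step i; rewrite Ti.
have M4 : (if m0 then 4 else 1) * 2 ^ l1 <= M by case: (m0) y2 HM; lia.
exists (M - (if m0 then 4 else 1) * 2 ^ l1).
  by move: M4; case: (m0); lia.
exists (x0 + 2 ^ l1), (if m0 then l.-1 else l.+1), m0; split.
- split=> //=; rewrite /upd /=.
    by rewrite /l1; case: (m0) => //; rewrite expnSr.
  by rewrite fr'.
- split=> //=.
  + by move=> r r8 rw rr; rewrite /upd !ifF ?fr' ?frs //; rewrite ?inE; lia.
  + by rewrite /upd /= fr'.
  + by move=> j; rewrite a2 ru step.
- split; first by lia.
    by move: y2; rewrite /l1; case: (m0) => /=; rewrite ?expnSr; lia.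
  (* The target promised in the block is not in the lower half, so it is in the upper one. *)
  move=> m1; have [_ [i xi Ti]] := wit m1; split; first by rewrite m1; lia.
  exists i => //; have := found_step (x := x0) (y := 2 ^ l1).
  have : ~~ (i < x0 + 2 ^ l1) by apply/negP => lt_i; have := step i; rewrite Ti lt_i; lia.
  by move: y2 xi; rewrite /l1 m1; lia.
- rewrite efound; move: q1 q2; rewrite /l1; case: (m0) l_gt0 => [/(_ isT)|_] /=; lia.
- by move: y2 HM M4; rewrite /l1; case: (m0) => /=; rewrite ?expnSr; lia.
Qed.

(** The new target contributes [2 * L + 2] to the query budget, which covers at most [L + 1]
    doubling and [L] halving queries spent on it. *)
Lemma gallop_record s0 q0 k0 M s q k x (mode : bool) k' :
  gallop_inv s0 q0 k0 M s q k -> reg s rx = x -> reg s rs = 1 ->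
  mode -> reg s rmode = mode -> x < n -> k' <= k + 10 ->
  exists2 M', M' < M &
    gallop_inv s0 q0 k0 M' (set_reg (set_reg (set_reg
      (set_arr s 2 (v * n + x) 1) rx (x + 1)) rs 1) rmode 0) q k'.
Proof.
move=> [x0 [l0 [m0 [[sx s2l sm g0] [frs sside sB ru] [x2n lx wit] [q1 q2] [HM Hk]]]]].
rewrite sx sm => <- s2l' m1 Em; have {Em m1}E : m0 = true by move: m1 Em; case: (mode); case: (m0).
move: E q1 q2 HM wit => -> q1 q2 HM wit xn lek.
have {s2l' s2l}E : l0 = 0 by apply/eqP; rewrite -(@eqn_exp2l 2) // -s2l s2l'.
move: lx q1 q2 HM wit; rewrite {}E expn0 => lx q1 q2 HM wit.
have Tx : target x0.
  have [_ [i xi Ti]] := wit isT; rewrite (_ : x0 = i) //; lia.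
have efound : found x0.+1 = found x0 + 1.
  rewrite -[X in _ = _ + X]/(nat_of_bool true) -Tx -count_in_add1 ?ltnn //.
  by apply: eq_count_in => i _ _; lia.
exists (M - 2); first by lia.
exists x0.+1, 0, false; split.
- by split=> //=; rewrite /upd /= addn1.
- split=> //=.
    by move=> r r8 rw rr; rewrite /upd !ifF ?frs //; lia.
  move=> j; rewrite /upd /=; case: eqP => [->|jx].
    by rewrite leq_addr addKn Tx ltnSn.
  rewrite ru; case: (leqP (v * n) j) => //= vj; case: (target _) => //=.
  by rewrite (_ : (j - v * n < x0.+1) = (j - v * n < x0)) //; lia.
- by split=> //; lia.
- by rewrite efound; lia.
- by lia.
Qed.

Lemma wp_gallop_step s0 q0 k0 M s q k :
  gallop_inv s0 q0 k0 M s q k ->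
  reg s0 rn = n -> reg s0 rv = v -> reg s0 rm = m -> reg s0 ra = half_test d (e B) ->
  reg s rx < n ->
  wpU gallop_step
    (fun s' q' k' => exists2 M', M' < M & gallop_inv s0 q0 k0 M' s' q' k') s q k.+1.
Proof.
move=> inv0 n0 v0 m0 a0 xn.
have [x [l [mode [[sx ss smode g0] [frs ss3 sB _] [x2n lx _] _ _]]]] := inv0.
have sn : reg s rn = n by rewrite frs.
have sv : reg s rv = v by rewrite frs.
have sm : reg s rm = m by rewrite frs.
have sa : reg s ra = half_test d (e B) by rewrite frs.
clear frs n0 v0 m0 a0; rewrite sx in xn.
apply: (wp_if U1) => //=; rewrite smode ss => cond; last first.
  have m1 : mode by case: (mode) cond; clear; lia.
  have l1 : 2 ^ l = 1.
    by have := expn_gt0 2 l; move: cond; rewrite m1; clear; lia.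
  apply: wp_seq; apply: (wp_store _ U1) => //=.
  apply: wp_seq; apply: (wp_assign _ U1) => //=.
    by rewrite sx; move: xn nU; clear; lia.
  apply: wp_seq; apply: (wp_assign _ U1) => //=; first exact: ltnW.
  apply: (wp_assign _ U1) => //=.
  rewrite sn sv sx; apply: (gallop_record inv0 (mode := mode)) => //.
    by rewrite ss.
  by clear; lia.
have l0 : mode -> 0 < l.
  by case: (l) cond => //; rewrite expn0; case: (mode); clear; lia.
set l1 := if mode then l.-1 else l.
have yE : 2 ^ l %/ (1 + mode) = 2 ^ l1.
  rewrite /l1; case: (mode) l0 => [/(_ isT)|_]; last by rewrite divn1.
  by case: (l) => // l' _; rewrite expnS mulKn.
have y0 : 0 < 2 ^ l1 by rewrite expn_gt0.
have yl : 2 ^ l1 <= 2 ^ l by rewrite -yE leq_div.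
(* A block may overshoot [n], but [2 ^ l <= x + 1 <= n] keeps its end below [2 * n]. *)
have yU : 2 ^ l1 <= U by move: yl lx xn nU; clear; lia.
have xyU : x + 2 ^ l1 <= U by move: yl lx xn nU; clear; lia.
apply: wp_seq; apply: (wp_assign _ U1) => //=; rewrite ss smode yE //.
apply: wp_seq; apply: (wp_assign _ U1) => //=; rewrite /upd /= sx sn.
  exact: leq_trans (leq_subr _ _) xyU.
apply: wp_seq; apply: (@block_test _ _ _ x (2 ^ l1)) => //.
  by rewrite /= /upd /=; clear; lia.
move=> s4 b fr4 a4 g4 s4B eb bP k4 lek4.
have fr4' : same_regs [:: rw; rr; rg; ry; rz] s s4.
  move=> r; rewrite !inE !negb_or => /and5P[r2 r4 r13 r14 r12].
  by rewrite fr4 ?inE ?negb_or ?r2 ?r4 ?r13 //= /upd (negbTE r12) (negbTE r14).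
have y4 : reg s4 ry = 2 ^ l1 by rewrite fr4.
have x4 : reg s4 rx = x by rewrite fr4' // sx.
have m4 : reg s4 rmode = mode by rewrite fr4' // smode.
have ss4 : reg s4 rs = 2 ^ l by rewrite fr4' // ss.
apply: (wp_if U1) => //=; rewrite fr4' // sa => hit.
  have wit : exists2 i, x <= i < x + 2 ^ l1 & target i.
    by apply/bP; rewrite -eb; apply/eqP => E; rewrite E subnn in hit.
  apply: wp_seq; apply: (wp_assign _ U1) => //=; first exact: ltnW.
  apply: (wp_assign _ U1) => //=; rewrite /upd /= y4 //.
  by apply: (gallop_hit inv0 sx ss smode) => //; rewrite -/l1; move: lek4; clear; lia.
have none : ~ (exists2 i, x <= i < x + 2 ^ l1 & target i).
  by move/bP; rewrite -eb => /eqP; apply; move: hit; clear; lia.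
apply: wp_seq; apply: (wp_assign _ U1) => //=; rewrite x4 y4 //.
have fin := gallop_empty inv0 sx ss smode xn l0 none fr4' g4 s4B a4.
apply: (wp_if U1) => //=; rewrite /upd /= m4 => mode1;
    apply: (wp_assign _ U1) => //=; rewrite /upd /= ?y4 ?ss4 //.
- have m1 : mode = true by case: (mode) mode1.
  by subst mode; apply: fin; rewrite -/l1; move: lek4; clear; lia.
- by move: lx xn nU; clear; lia.
- have m1 : mode = false by case: (mode) mode1.
  by subst mode; apply: fin; rewrite -/l1; move: lek4; clear; lia.
Qed.

(** At the end [n <= x <= 2 * n], and the mode is 0 because no target lies beyond [n]. The linear
    bound comes from [x <= 2 * n]; in the logarithmic one the last, fruitless run costs [l <= L + 1]
    queries. *)
Lemma wp_gallop (Q : state -> nat -> nat -> Prop) s q k :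
  reg s rn = n -> reg s rv = v -> reg s rm = m -> reg s rside = side ->
  (forall s' q' k',
     (forall r, r < 8 -> r \notin [:: rw; ra; rr] -> reg s' r = reg s r) ->
     row_upd (v * n) target (arr s 2) (arr s' 2) ->
     q' <= q + 4 * n + 2 ->
     q' <= q + count_in n target (fun=> true) * (2 * L + 2) + 2 * L + 2 ->
     k' <= k + 200 * n -> Q s' q' k') ->
  wpU gallop Q s q k.
Proof.
move=> sn sv sm sside HQ.
apply: wp_seq; apply: (wp_assign _ U1) => //.
apply: wp_seq; apply: (@wp_fill_all _ _ _ _ side false) => //.
rewrite /= {1}/upd /= sm => s1 fr1 a1 s1B.
apply: wp_seq; apply: (wp_ask s1B); first by apply: side_set_v.
- by exists i0.
- by exists m => //; rewrite mv andbT /side_set eqxx.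
do 3!(apply: wp_seq; apply: (wp_assign _ U1) => //=; try lia).
set s2 := set_reg (set_reg (set_reg _ rx _) _ _) _ _; set k2 := (k.+1 + 4 * n + 4).+4.
have fr2 r : r < 8 -> r \notin [:: rw; ra; rr] -> reg s2 r = reg s r.
  case: r => [|[|[|[|[|[|[|[|]]]]]]]] // _; rewrite !inE //= => _;
    by rewrite /s2 /= /upd /= fr1.
have s2B : holds n v s2 B by [].
have [s2x s2s s2m] : [/\ reg s2 rx = 0, reg s2 rs = 1 & reg s2 rmode = 0] by [].
have s2g : reg s2 rg = 0 by rewrite /s2 /= /upd /= fr1.
have s2side : reg s2 rside = side by rewrite /s2 /= /upd /= fr1.
have s2a : reg s2 ra = half_test d (e B) by [].
have a2 : arr s2 2 = arr s 2 by rewrite /s2 /= a1.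
have ek2 : k2 = (k.+1 + 4 * n + 4).+4 by [].
clearbody s2 k2; clear s1 fr1 a1 s1B.
apply: (@wp_while _ _ _ U1 _ _ (gallop_inv s2 q.+1 k2) _ (6 * n + 2)) => //.
- exists 0, 0, false; split=> //.
  + by split=> //; move=> j; rewrite ltn0 !andbF.
  + by split=> //; clear; lia.
  + by split; rewrite ?expn0; clear; lia.
- move=> M s3 q3 k3 inv3 /=; have [x [l [mode [[sx _ _ _] [frs _ _ _] _ _ _]]]] := inv3.
  rewrite sx frs // (fr2 rn) // sn => xn.
  apply: (wp_gallop_step inv3); rewrite ?(fr2 rn) ?(fr2 rv) ?(fr2 rm) // sx; move: xn; clear; lia.
- move=> M s3 q3 k3 [x [l [mode [[sx ss smode g0] [frs ss3 s3B ru] [x2n lx wit] [q1 q2] [HM Hk]]]]] /=.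
  have s3n : reg s3 rn = n by rewrite frs // fr2.
  rewrite s3n sx => xn; have {xn}nx : n <= x by lia.
  have modeF : mode = false.
    by case: (mode) wit => // /(_ isT)[_ [i xi /andP[/N_lt lt_in _]]]; lia.
  move: modeF q1 q2 HM => -> q1 q2 HM.
  have lL : l <= L.+1.
    have nL := trunc_log_ltn n (isT : 1 < 2).
    have : 2 ^ l < 2 ^ L.+2 by rewrite (expnS 2 L.+1); lia.
    by rewrite ltn_exp2l.
  have L1 : 0 < L by rewrite trunc_log_gt0 //; lia.
  apply: HQ.
  + move=> r r8 nr; rewrite frs ?fr2 //; move: nr; rewrite !inE; lia.
  + move=> j; rewrite ru a2; case Tj: (target _) => //=.
    by rewrite (leq_trans _ nx) //; apply: N_lt; case/andP: Tj.
  + by rewrite addn0 in q1; lia.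
  + have le_f : found x * (2 * L + 2) <= count_in n target (fun=> true) * (2 * L + 2).
      by rewrite leq_mul // leq_count_in.
    apply: leq_trans q2 _; move: le_f lL L1; clear; lia.
  + by move: Hk; rewrite ek2; lia.
Qed.

End Gallop.

(** * Bisection for the pivot *)

Notation below m := (side_set v m false false).
Notation test m := (half_test d (e (below m))).

(** The answers at the two ends stay different, so at gap one the answer changes between [m] and
    [m.+1]. The vertices [u] and [w], on either side of all midpoints, keep the queries proper. Each
    of the at most [T] rounds takes at most [4 * n + 10] steps. *)
Lemma wp_bisect (Q : state -> nat -> nat -> Prop) s q k a T lo hi u w :
  reg s rn = n -> reg s rv = v -> reg s rside = 0 -> reg s rg = 0 -> reg s ra = a ->
  reg s rlo = lo -> reg s rhi = hi ->
  u < lo -> lo < hi -> hi <= w -> w < n -> u != v -> w != v ->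
  test lo = a -> test hi <> a -> hi - lo <= 2 ^ T ->
  (forall s' q' k' m,
     same_regs [:: rw; rr; rlo; rhi; rm; rx; rz] s s' -> arr s' 2 = arr s 2 ->
     reg s' rlo = m -> lo <= m < hi -> test m = a -> test m.+1 <> a ->
     q' <= q + T -> k' <= k + T * (4 * n + 10) + 1 -> Q s' q' k') ->
  wpU bisect Q s q k.
Proof.
move=> sn sv sside sg sa slo shi ulo lohi hiw wn uv wv tlo thi hT HQ.
pose I M s' q' k' := exists l h,
  [/\ same_regs [:: rw; rr; rlo; rhi; rm; rx; rz] s s', arr s' 2 = arr s 2,
      [/\ reg s' rlo = l, reg s' rhi = h, test l = a & test h <> a],
      [/\ lo <= l, l < h, h <= hi & h - l <= 2 ^ M] &
      q' + M <= q + T /\ k' + M * (4 * n + 10) <= k + T * (4 * n + 10)].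
apply: (@wp_while _ _ _ U1 _ _ I _ T) => //; first by exists lo, hi.
- move=> M s1 q1 k1 [l [h [fr a1 [s1lo s1hi tl th] [lol lh hhi hM] [qM kM]]]] /=.
  rewrite s1lo s1hi => gap.
  have M0 : 0 < M by case: (M) hM; move: gap; clear; lia.
  have l2 : 2 ^ M = 2 * 2 ^ M.-1 by rewrite -expnS prednK.
  pose p := (l + h) %/ 2.
  have [lp ph hM1] : [/\ l < p, p < h & (p - l <= 2 ^ M.-1) && (h - p <= 2 ^ M.-1)].
    by rewrite /p; split; move: gap hM; rewrite l2; clear; lia.
  have [up pw] : u < p /\ p <= w by lia.
  apply: wp_seq; apply: (wp_assign _ U1) => //=; rewrite s1lo s1hi -/p.
    by move: ph hhi hiw wn nU; clear; lia.
  apply: wp_seq; apply: (@wp_fill_all _ _ _ _ false false) => //=;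
    rewrite /upd /= ?fr //.
  move=> s2 fr2 a2 s2A.
  apply: wp_seq; apply: (wp_ask s2A); first exact: side_set_v.
  - exists u; first by lia.
    by rewrite /side_set uv up andbT (ltn_eqF up).
  - exists w => //; rewrite wv andbT /side_set.
    by rewrite [w < p]ltnNge pw !andbF.
  have fr' r : r \notin [:: rw; rr; rlo; rhi; rm; rx; rz] -> reg s2 r = reg s r.
    rewrite !inE !negb_or => /and5P[r2 r4 r5 r6 /and3P[r7 r8 r12]].
    rewrite fr2 ?inE ?negb_or ?r2 ?r8 ?r12 //= /upd (negbTE r7) fr //.
    by rewrite !inE !negb_or; apply/and5P; split=> //; apply/and3P.
  have p2 : reg s2 rm = p by rewrite fr2.
  have lo2 : reg s2 rlo = l by rewrite fr2.
  have hi2 : reg s2 rhi = h by rewrite fr2.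
  have pU : p <= U by move: ph hhi hiw wn nU; clear; lia.
  have k2 : forall k2, k2 <= k1.+1 + 4 * n + 9 ->
    k2 + M.-1 * (4 * n + 10) <= k + T * (4 * n + 10).
    by move=> k2 lek2; case: (M) M0 kM => // M' _; rewrite mulSn /=; move: lek2; clear; lia.
  apply: (wp_if U1) => //=; rewrite /upd /= fr' // sa => hit;
    apply: (wp_assign _ U1) => //=; rewrite /upd /= ?p2 //; exists M.-1; rewrite ?prednK //.
  + exists l, p; split=> //=.
    * move=> r nr; have := nr; rewrite !inE !negb_or => /and5P[r2 r4 r5 r6 _].
      by rewrite /= !upd_neq ?fr'.
    * by rewrite a2.
    * by split=> //; move=> E; move: hit; rewrite E subnn.
    * by split=> //; [exact: ltnW (leq_trans ph hhi) | case/andP: hM1].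
    * by split; [move: qM M0; clear; lia | apply: k2; clear; lia].
  + exists p, h; split=> //=.
    * move=> r nr; have := nr; rewrite !inE !negb_or => /and5P[r2 r4 r5 r6 _].
      by rewrite /= !upd_neq ?fr'.
    * by rewrite a2.
    * by split=> //; move: hit; clear; lia.
    * by split=> //; [exact: ltnW (leq_ltn_trans lol lp) | case/andP: hM1].
    * by split; [move: qM M0; clear; lia | apply: k2; clear; lia].
- move=> M s1 q1 k1 [l [h [fr a1 [s1lo s1hi tl th] [lol lh hhi hM] [qM kM]]]] /=.
  rewrite s1lo s1hi => gap.
  have hl : h = l.+1 by lia.
  apply: (HQ _ _ _ l) => //.
  + by rewrite lol; lia.
  + by rewrite -hl.
  + by lia.
  + by move: kM; clear; lia.
Qed.

(** * The two extreme comparisons and the whole row *)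

Notation first := (1 - v).
Notation last := (n - 1 - (1 - (n - 1 - v))).
Notation mid := (1 + (1 - (v - 1))).

Lemma N_neq i : N i -> i != v.
Proof. by move=> Ni; apply/eqP => E; rewrite E Nv in Ni. Qed.

Lemma leq_target P : count_in n (fun i => N i && P i) (fun=> true) <= d.
Proof. by apply: leq_sum => i _ /=; case: (N i); case: (P i). Qed.

Lemma count_below_first : e (below first.+1) = N first.
Proof.
rewrite -(@count_in1 n); last by move: n3; clear; lia.
by apply: eq_count_in => i _ /N_neq; rewrite /side_set; move: n3; clear; lia.
Qed.

Lemma count_below_last : e (below last) + N last = d.
Proof.
have lastn : last < n by move: n3; clear; lia.
rewrite -(@count_inC n N (eq_op^~ last)) count_in1 // addnC; congr (_ + _).
apply: eq_count_in => i lt_in /N_neq; rewrite /side_set; move: n3 vn lt_in; clear; lia.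
Qed.

Lemma count_below_S m : m < n -> m != v -> e (below m.+1) = e (below m) + N m.
Proof.
move=> mn mv; rewrite -count_in_add1 //; last by rewrite /side_set eqxx.
by apply: eq_count_in => i _ Ni; rewrite /side_set; move: mv; clear; lia.
Qed.

(** Hence bisection cannot stop at [v]. *)
Lemma below_S_self : e (below v.+1) = e (below v).
Proof. by apply: eq_count_in => i _ /N_neq; rewrite /side_set; clear; lia. Qed.

Lemma count_above m : m < n -> e (below m) + N m + e (side_set v m true false) = d.
Proof.
move=> mn; rewrite -(@count_inC n N (fun i => below m i || (i == m))).
rewrite count_in_add1 //; last by rewrite /side_set eqxx.
by congr (_ + _); apply: eq_count_in => i _ /N_neq; rewrite /side_set; clear; lia.
Qed.

Lemma leq_count_two i j : i < n -> j < n -> i != j -> N i + N j <= d.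
Proof.
move=> lt_in lt_jn ij; rewrite -(@count_in1 n N i) // -(@count_in_add1 n N (eq_op^~ i)) //.
  exact: leq_count_in.
by rewrite eq_sym; apply/negbTE.
Qed.

Lemma only_two i j k : i < n -> j < n -> i != j -> d = N i + N j -> N k -> k = i \/ k = j.
Proof.
move=> lt_in lt_jn ij dE Nk; case: (eqVneq k i) => [|ki]; first by left.
case: (eqVneq k j) => [|kj]; [by right | exfalso].
have : e (fun x => ((x == i) || (x == j)) || (x == k)) <= d by apply: leq_count_in.
rewrite count_in_add1 ?N_lt //; last by rewrite (negbTE ki) (negbTE kj).
rewrite count_in_add1 //; last by rewrite eq_sym; apply/negbTE.
by rewrite count_in1 // Nk dE; clear; lia.
Qed.

(** The signs compared are those of [d - 2 * b1] and [2 * b2 - d]. For [d > 2] the first is positive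
    and the second negative, so agreement leaves [d <= 2]. The answers 0 and 2 then mean [d = 1] and
    name the neighbour; the answer 1 leaves [d = 0] or [d = 2]. *)
Lemma half_test_ends (b1 b2 : bool) :
  b1 + b2 <= d -> half_test d (nat_of_bool b1) = half_test d (d - nat_of_bool b2) ->
  [/\ d = b1 + b2,
      half_test d (nat_of_bool b1) != 1 ->
        1 - half_test d (nat_of_bool b1) = b1 /\ half_test d (nat_of_bool b1) %/ 2 = b2 &
      half_test d (nat_of_bool b1) = 1 -> b1 = b2].
Proof.
by rewrite /half_test; case: b1; case: b2; do ![case: ifP => ?]; split; lia.
Qed.

Lemma L_gt0 : 0 < L. Proof. by rewrite trunc_log_gt0 //; move: n3; clear; lia. Qed.
Lemma L_lt : L < n.
Proof.
apply: leq_trans (ltn_expl L (isT : 1 < 2)) _; apply: trunc_logP => //.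
by move: n3; clear; lia.
Qed.

Lemma wp_dense_row (Q : state -> nat -> nat -> Prop) s q k a lo hi :
  reg s rn = n -> reg s rv = v -> reg s rside = 0 -> reg s rg = 0 -> reg s ra = a ->
  reg s rlo = lo -> reg s rhi = hi -> lo = first.+1 -> hi = last ->
  test lo = a -> test hi <> a ->
  (forall s' q' k', reg s' rn = n -> reg s' rv = v ->
     row_upd (v * n) N (arr s 2) (arr s' 2) ->
     q' <= q + L + 8 * n + 5 -> q' <= q + d * (4 * L + 4) + 5 * L + 5 ->
     k' <= k + 450 * (n * L) -> Q s' q' k') ->
  wpU dense_row Q s q k.
Proof.
move=> sn sv sside sg sa slo shi loE hiE tlo thi HQ.
(* [lo <= hi] holds from [n = 3] on, and equality would make the two tests agree. *)
have lohi : lo < hi.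
  have : lo <= hi by rewrite loE hiE; move: n3; clear; lia.
  by rewrite leq_eqVlt => /orP[/eqP E|//]; rewrite E in tlo.
have firstv : first != v by clear; lia.
have lastv : last != v by move: n3; clear; lia.
have lastn : last < n by move: n3; clear; lia.
apply: wp_seq; apply: (@wp_bisect _ _ _ _ a L.+1 lo hi first last) => //.
- by rewrite loE.
- by rewrite hiE.
- have := trunc_log_ltn n (isT : 1 < 2); rewrite hiE; clear; lia.
move=> s1 q1 k1 m fr1 a1 lo1 /andP[lom mhi] tm tm1 leq1 lek1.
have mn : m < n by rewrite hiE in mhi; exact: ltn_trans mhi lastn.
have mv : m != v by apply/eqP => mv; apply: tm1; rewrite -tm mv below_S_self.
have Nm : N m = true.
  by apply/negP => /negP Nm; rewrite count_below_S // (negbTE Nm) addn0 tm in tm1.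
have eS : e (below m.+1) = (e (below m)).+1 by rewrite count_below_S // Nm addn1.
have pivot : half_test d (e (below m)) <> half_test d (e (below m)).+1.
  by rewrite -eS tm => E; apply: tm1.
(* The sets below and above [m] have [d - 1] neighbours together, so [half_test_compl] carries the
   change of sign over. Answers being at most 2, the truncated [2 - _] is injective on them. *)
have pivot' : half_test d (e (side_set v m true false)) <>
              half_test d (e (side_set v m true false)).+1.
  have dE := count_above mn; rewrite Nm /= in dE.
  have -> : (e (side_set v m true false)).+1 = d - e (below m) by move: dE; clear; lia.
  have -> : e (side_set v m true false) = d - (e (below m)).+1 by move: dE; clear; lia.
  rewrite !half_test_compl; try by move: dE; clear; lia.
  have := half_test_le2 d (e (below m)); have := half_test_le2 d (e (below m)).+1.
  by move: pivot; clear; lia.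
have mU : m <= U by move: mn nU; clear; lia.
apply: wp_seq; apply: (wp_assign _ U1) => //=; rewrite lo1 //.
apply: wp_seq; apply: (wp_store _ U1) => //=; rewrite /upd /= !fr1 // sv sn.
apply: wp_seq; apply: (@wp_gallop false m first mn mv) => //=; rewrite /upd /= ?fr1 //.
- by move: n3; clear; lia.
- by rewrite /side_set firstv /=; move: lom loE; clear; lia.
move=> s2 q2 k2 fr2 up2 leq2 leq2' lek2.
have U2 : 1 <= U by move: U1; clear; lia.
apply: wp_seq; apply: (wp_assign _ U1) => //=.
apply: (@wp_gallop true m last mn mv) => //=; rewrite /upd /= ?fr2 //= /upd /= ?fr1 //.
- by rewrite /side_set lastv /=; move: mhi hiE; clear; lia.
move=> s3 q3 k3 fr3 up3 leq3 leq3' lek3.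
apply: HQ.
- by rewrite fr3 // fr2 // fr1.
- by rewrite fr3 // fr2 // fr1.
(* The direct store and the two gallops cover the three positions of a neighbour relative to [m]. *)
- move=> j; rewrite up3 up2 a1 /=.
  case: (leqP (v * n) j) => /= [vj|jv]; last first.
    by rewrite ifF //; move: jv; clear; lia.
  case: (eqVneq j (v * n + m)) => [->|jm]; first by rewrite addKn Nm !if_same.
  case Nj: (N _) => //=.
  have := N_neq Nj; rewrite /side_set; case: (ltngtP (j - v * n) m) => //= [lt_jm|lt_mj|jE] jv.
  + by rewrite jv.
  + by rewrite jv.
  + by case/eqP: jm; rewrite -jE subnKC.
- by move: leq1 leq2 leq3; clear; lia.
- have le_t P : count_in n (fun i => N i && P i) (fun=> true) * (2 * L + 2) <= d * (2 * L + 2).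
    by rewrite leq_mul // leq_target.
  have := le_t (fun i => ~~ below m i && (i != m)).
  have := le_t (fun i => ~~ side_set v m true false i && (i != m)).
  by move: leq1 leq2' leq3' => /=; clear; lia.
- have nL : n <= n * L by rewrite leq_pmulr // L_gt0.
  have LL : L <= n * L by rewrite leq_pmull //; move: n3; clear; lia.
  by move: lek1 lek2 lek3 nL LL n3; clear; lia.
Qed.

(** Here the degrees of [v] and [u] are compared. As [u] will have degree 1, the codes 0 and 2
    coincide with [d] itself. *)
Hypothesis O_three : n = 3 -> d = 0 \/ d = 2 -> forall s u, u < n -> u != v ->
  (forall i, i < n -> (arr s 1 i != 0) = (i == u)) ->
  (forall i, i < n -> (arr s 0 i != 0) = (i == v)) ->
  answer (O (arr_set n s 0) (arr_set n s 1)) = d.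

Lemma wp_sparse_row (Q : state -> nat -> nat -> Prop) s q k a :
  reg s rn = n -> reg s rv = v -> reg s rside = 0 -> reg s rg = 0 -> reg s ra = a ->
  reg s rr = a -> holds n v s (below last) -> test first.+1 = a -> test last = a ->
  (forall j, v * n <= j -> arr s 2 j = 0) ->
  (forall s' q' k', reg s' rn = n -> reg s' rv = v ->
     row_upd (v * n) N (arr s 2) (arr s' 2) ->
     q' <= q + 1 -> k' <= k + 450 * (n * L) -> Q s' q' k') ->
  wpU sparse_row Q s q k.
Proof.
move=> sn sv sside sg sa sr sB tf tl s0 HQ.
have firstv : first != v by clear; lia.
have lastv : last != v by move: n3; clear; lia.
have firstn : first < n by move: n3; clear; lia.
have lastn : last < n by move: n3; clear; lia.
have fl : first < last by move: n3 vn; clear; lia.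
have fl' : first != last by rewrite ltn_eqF.
have dl : d - N last = e (below last) by have := count_below_last; clear; lia.
have nL : n <= n * L by rewrite leq_pmulr // L_gt0.
have [] := @half_test_ends (N first) (N last).
- exact: leq_count_two.
- by rewrite dl -count_below_first tf tl.
rewrite -count_below_first tf count_below_first => dE ends mids.
have fU x : x <= 4 -> x <= U by move: nU n3; clear; lia.
have bU (b : bool) : b <= U by apply: fU; case: b.
have a2 : a <= 2 by rewrite -tf half_test_le2.
apply: wp_seq.
(* All branches reduce to finding the two possibly nonzero bits of the row, left in [rlo] and
   [rhi]. *)
pose R := fun s' q' k' => [/\ reg s' rn = n, reg s' rv = v, arr s' 2 = arr s 2 &
  [/\ reg s' rlo = N first, reg s' rhi = N last, q' <= q + 1 & k' <= k + 4 * n + 15]].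
apply: (@wp_conseq _ _ _ _ R); last first.
  move=> s1 q1 k1 [s1n s1v a1 [lo1 hi1 leq1 lek1]].
  apply: wp_seq; apply: (wp_store _ U1) => //=; rewrite s1v s1n lo1.
  apply: (wp_store _ U1) => //=; rewrite /upd /= s1v s1n hi1.
  apply: HQ => //=; last by move: lek1 nL n3; clear; lia.
  move=> j; rewrite /upd /=; case: (eqVneq j (v * n + last)) => [->|jl].
    by rewrite leq_addr addKn s0 ?leq_addr //; case: (N last).
  case: (eqVneq j (v * n + first)) => [->|jf].
    by rewrite leq_addr addKn s0 ?leq_addr //; case: (N first).
  rewrite a1; case: (leqP (v * n) j) => //= vj; case Nj: (N _) => //.
  have [E|E] := only_two firstn lastn fl' dE Nj.
    by case/eqP: jf; rewrite -E subnKC.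
  by case/eqP: jl; rewrite -E subnKC.
apply: (wp_if U1) => //=; rewrite sa => a1.
  have a1' : a != 1 by apply/eqP => E; rewrite E in a1.
  have [e1 e2] := ends a1'.
  apply: wp_seq; apply: (wp_assign _ U1) => //=; rewrite /upd /= ?sa ?e1 //.
  apply: (wp_assign _ U1) => //=; rewrite /upd /= ?sa ?e2 //.
  by split=> //; split=> //; move: n3; clear; lia.
have {}a1 : a = 1 by move: a1; clear; lia.
have Nfl := mids a1; rewrite -Nfl in dE.
apply: wp_seq; apply: (wp_if U1) => //=; rewrite sn => n3'.
  have midn : mid < n by move: n3 n3'; clear; lia.
  have midv : mid != v by clear; lia.
  have midf : mid != first by clear; lia.
  have midl : mid != last by move: n3 n3'; clear; lia.
  have Nmid : N mid = false.
    apply/negP => Nm; rewrite Nfl in dE; rewrite -{1}Nfl in dE.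
    have [] := only_two firstn lastn fl' dE Nm; exact/eqP.
  apply: wp_seq; apply: (wp_assign _ U1) => //=; rewrite sv; first by apply: fU; clear; lia.
  apply: wp_seq; apply: (wp_assign _ U1) => //=; first exact: fU.
  apply: wp_seq; apply: (@wp_fill_all _ _ _ _ false true) => //=; rewrite /upd /= ?sv //.
  move=> s2 fr2 a2' s2A; rewrite /upd /= in s2A.
  (* Only [first] and [last] can be neighbours, so omitting [mid] loses none. The answer
     [half_test d d] is 1 for [d = 0] and 0 for [d = 2]. *)
  have eA : e (side_set v mid false true) = d.
    rewrite -(@count_inC n N (eq_op^~ mid)) count_in1 // Nmid add0n.
    by apply: eq_count_in => i _ /N_neq iv; rewrite /side_set iv andbT.
  apply: wp_seq; apply: (wp_ask s2A); first exact: side_set_v.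
  - exists first => //; by rewrite /side_set eq_sym midf firstv.
  - by exists mid => //; rewrite midv /side_set eqxx.
  apply: (wp_assign _ U1) => //=; rewrite /upd /= eA.
    by rewrite (leq_trans (leq_subr _ _)) ?fU.
  have res : 1 - half_test d d = N first by rewrite dE; case: (N first).
  apply: (wp_assign _ U1) => //=; rewrite /upd /= res //.
  have [s2n s2v] : reg s2 rn = n /\ reg s2 rv = v by rewrite !fr2.
  by split=> //; split=> //; rewrite -?Nfl //; clear; lia.
have {}n3' : n = 3 by move: n3 n3'; clear; lia.
apply: wp_seq; apply: (wp_store _ U1) => //=; rewrite sv.
set s1 := set_arr _ _ _ _.
have s1u i : i < n -> (arr s1 1 i != 0) = (i == first).
  move=> lt_in; rewrite /= /upd /= (sB i lt_in).1 /side_set.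
  by move: lt_in vn; rewrite n3'; clear; lia.
have s1v i : i < n -> (arr s1 0 i != 0) = (i == v).
  move=> lt_in; rewrite /= /upd /=; case: (eqVneq i first) => [->|inf].
    by rewrite eqxx (negbTE firstv).
  rewrite (sB i lt_in).2 /side_set.
  by move: inf lt_in vn; rewrite n3'; clear; lia.
have d02 : d = 0 \/ d = 2 by rewrite dE; case: (N first); [right | left].
have O1 := O_three n3' d02 firstn firstv s1u s1v.
apply: wp_seq; apply: (wp_query U1).
- split=> [/setP/(_ (Ordinal vn))|/setP/(_ (Ordinal firstn))]; rewrite !inE s1v //= ?eqxx //.
  by rewrite (negbTE firstv).
- split=> [/setP/(_ (Ordinal firstn))|/setP/(_ (Ordinal vn))]; rewrite !inE s1u //= ?eqxx //.
  by rewrite eq_sym (negbTE firstv).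
rewrite O1; have d2 : d %/ 2 = N first by rewrite dE; case: (N first).
apply: (wp_assign _ U1) => //=; rewrite /upd /= ?d2 //.
apply: (wp_assign _ U1) => //=; rewrite /upd /= ?d2 //.
by split=> //; split=> //; rewrite -?Nfl //; clear; lia.
Qed.

Lemma wp_row (Q : state -> nat -> nat -> Prop) s q k :
  reg s rn = n -> reg s rv = v -> (forall j, v * n <= j -> arr s 2 j = 0) ->
  (forall s' q' k', reg s' rn = n -> reg s' rv = v ->
     row_upd (v * n) N (arr s 2) (arr s' 2) ->
     q' <= q + 20 * minn n ((d + 1) * L) -> k' <= k + 500 * (n * L) -> Q s' q' k') ->
  wpU row Q s q k.
Proof.
move=> sn sv s0 HQ.
have firstv : first != v by clear; lia.
have lastv : last != v by move: n3; clear; lia.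
have firstn : first < n by move: n3; clear; lia.
have lastn : last < n by move: n3; clear; lia.
have fl : first < last by move: n3 vn; clear; lia.
have fU x : x <= n -> x <= U by move: nU n3; clear; lia.
have nL : n <= n * L by rewrite leq_pmulr // L_gt0.
apply: wp_seq; apply: (wp_assign _ U1) => //=.
apply: wp_seq; apply: (wp_assign _ U1) => //=.
apply: wp_seq; apply: (wp_assign _ U1) => //=; rewrite /upd /= sv addn1; first exact: fU.
apply: wp_seq; apply: (@wp_fill_all _ _ _ _ false false) => //=; rewrite /upd /= ?sv //.
move=> s1 fr1 a1 s1A; rewrite /upd /= in s1A.
apply: wp_seq; apply: (wp_ask s1A); first exact: side_set_v.
- by exists first => //; rewrite /side_set firstv ltnSn andbT /=; clear; lia.
- exists last => //; rewrite lastv andbT /side_set; move: fl; clear; lia.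
apply: wp_seq; apply: (wp_assign _ U1) => //=; rewrite /upd /= fr1 //= /upd /=; first exact: fU.
apply: wp_seq; apply: (wp_assign _ U1) => //=; rewrite /upd /= !fr1 //= /upd /= sn sv.
  by apply: fU; exact: ltnW.
apply: wp_seq; apply: (@wp_fill_all _ _ _ _ false false) => //=; rewrite /upd /= ?fr1 //.
move=> s2 fr2 a2 s2A; rewrite /upd /= in s2A.
apply: wp_seq; apply: (wp_ask s2A); first exact: side_set_v.
- by exists first => //; rewrite /side_set firstv fl andbT /= neq_ltn fl.
- exists last => //; rewrite lastv andbT /side_set eqxx //.
apply: wp_seq; apply: (wp_assign _ U1) => //=; rewrite /upd /= fr2 //= /upd /=.
  by apply: fU; exact: ltnW.
have E2 : arr s2 2 = arr s 2 by rewrite a2 /= a1.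
apply: (wp_if U1) => //=; rewrite /upd /= fr2 //= /upd /= => ab.
  apply: (@wp_dense_row _ _ _ _ (test first.+1) first.+1 last) => //=;
    rewrite /upd /= ?fr2 //= /upd /= ?fr1 //.
    by move=> E; rewrite E subnn in ab.
  rewrite E2 => s3 q3 k3 n3' v3 up3 leq3 leq3' lek3; apply: HQ => //.
    (* The linear bound uses [L < n]; the logarithmic one absorbs its constants using [1 <= L]. *)
    have dL : d <= d * L by rewrite leq_pmulr // L_gt0.
    have [->|->] : minn n ((d + 1) * L) = n \/ minn n ((d + 1) * L) = (d + 1) * L.
      by rewrite /minn; case: ifP; [left | right].
    - by move: leq3 L_lt n3; clear; lia.
    - by move: leq3' L_gt0 dL; clear; lia.
  by move: lek3 nL n3; clear; lia.
apply: (@wp_sparse_row _ _ _ _ (test first.+1)) => //=;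
  rewrite /upd /= ?fr2 //= /upd /= ?fr1 //.
- by move: ab; clear; lia.
- by move: ab; clear; lia.
- by rewrite E2.
rewrite E2 => s3 q3 k3 n3' v3 up3 leq3 lek3; apply: HQ => //.
  have : 1 <= minn n ((d + 1) * L) by rewrite leq_min muln_gt0 addn1 L_gt0 andbT; move: n3; clear; lia.
  by move: leq3; clear; lia.
by move: lek3 nL n3; clear; lia.
Qed.

End Row.

(** * Cuts and degrees *)

Section Graph.

Variables (n : nat) (E : {set {set 'I_n}}).
Hypothesis simpleE : simple_graph E.

(** Extended by [false] outside the vertex range, to match the predicates on naturals that specify
    the program. *)
Definition adj (i j : nat) : bool :=
  [exists a : 'I_n, exists b : 'I_n, [&& a == i :> nat, b == j :> nat & [set a; b] \in E]].

Notation deg i := (count_in n (adj i) (fun=> true)).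

Lemma adjE (a b : 'I_n) : adj a b = ([set a; b] \in E).
Proof.
apply/existsP/idP => [[a' /existsP[b' /and3P[/eqP/val_inj-> /eqP/val_inj-> //]]]|abE].
by exists a; apply/existsP; exists b; rewrite !eqxx.
Qed.

Lemma adj_lt i j : adj i j -> j < n.
Proof. by case/existsP => a /existsP[b /and3P[_ /eqP <- _]]. Qed.

Lemma adjC i j : adj i j = adj j i.
Proof.
by apply/idP/idP => /existsP[a /existsP[b /and3P[ai bj abE]]]; apply/existsP; exists b;
  apply/existsP; exists a; rewrite ai bj setUC.
Qed.

Lemma adjxx i : adj i i = false.
Proof.
apply/idP => /existsP[a /existsP[b /and3P[/eqP <- /eqP/val_inj ->]]].
by rewrite setUid => /simpleE; rewrite cards1.
Qed.

Lemma edge_at v e : e \in E -> v \in e -> exists2 w, w != v & e = [set v; w].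
Proof.
move=> eE ve; have /eqP/cards2P[x [y [xy eq_e]]] := simpleE eE.
move: ve; rewrite eq_e !inE => /orP[]/eqP ->.
  by exists y => //; rewrite eq_sym.
by exists x => //; rewrite setUC.
Qed.

Lemma count_inE v A : count_in n (adj v) A = #|[set w : 'I_n | A w && adj v w]|.
Proof.
rewrite -sum1_card big_mkcond; apply: eq_bigr => w _ /=.
by rewrite inE; case: ifP.
Qed.

(** Sending a neighbour [w] to the edge joining it to [v] is injective, and its image consists of
    the edges at [v]. *)
Lemma card_edges_at (v : 'I_n) (A : nat -> bool) (P : {set {set 'I_n}}) :
  (forall w, w != v -> ([set v; w] \in P) = A w) ->
  #|[set e in E | (v \in e) && (e \in P)]| = count_in n (adj v) A.
Proof.
move=> PA; rewrite count_inE -(@card_in_imset _ _ (fun w => [set v; w])).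
  congr #|pred_of_set _|; apply/setP => e; rewrite inE.
  apply/and3P/imsetP => [[eE ve eP]|[w]].
    have [w wv eq_e] := edge_at eE ve; exists w => //.
    by rewrite inE adjE -eq_e eE andbT -PA // -eq_e.
  rewrite inE adjE => /andP[Aw vwE] ->; split=> //; first by rewrite !inE eqxx.
  rewrite PA //; apply/eqP => wv; move: vwE; rewrite wv setUid => /simpleE.
  by rewrite cards1.
move=> w w' /[!inE] /andP[_ vw] /andP[_ vw'] /setP/(_ w).
rewrite !inE eqxx orbT => /esym/orP[/eqP wv|/eqP //].
by move: vw; rewrite wv adjxx.
Qed.

Lemma card_degree (v : 'I_n) : #|[set e in E | v \in e]| = deg v.
Proof.
rewrite -(@card_edges_at v (fun=> true) setT) => [|w _]; last by rewrite inE.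
by congr #|pred_of_set _|; apply/setP => e; rewrite !inE andbT.
Qed.

(** Handshake lemma: incidences are counted by vertices and by edges. *)
Lemma sum_degrees : \sum_(0 <= v < n) deg v = 2 * #|E|.
Proof.
rewrite big_mkord (eq_bigr (fun v : 'I_n => \sum_(e in E) (v \in e))); last first.
  move=> v _; rewrite -card_degree -sum1_card big_mkcond [in RHS]big_mkcond /=.
  by apply: eq_bigr => e _; rewrite inE; case: (e \in E); case: (v \in e).
rewrite exchange_big /= (eq_bigr (fun=> 2)); first by rewrite sum_nat_const mulnC.
move=> e eE; rewrite -(simpleE eE) -sum1_card [RHS]big_mkcond /=.
by apply: eq_bigr => v _; case: (v \in e).
Qed.

Lemma card_cut_split (v : 'I_n) S :
  #|cut E S| = #|[set e in E | (v \in e) && (e \in [set e | #|e :&: S| == 1])]|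
             + #|[set e in E | (v \notin e) && (#|e :&: S| == 1)]|.
Proof.
rewrite -(cardsID [set e : {set 'I_n} | v \in e] (cut E S)).
congr (_ + _); apply: eq_card => e; rewrite !inE;
  by case: (e \in E); case: (v \in e); rewrite ?andbT ?andbF.
Qed.

Lemma cards2I (v w : 'I_n) S : w != v ->
  #|[set v; w] :&: S| = (v \in S) + (w \in S).
Proof.
move=> wv; rewrite -sum1_card big_mkcond /= (bigD1 v) //= (bigD1 w) //=.
rewrite !inE !eqxx orbT /= big1 ?addn0 => [|i /andP[iv iw]].
  by case: (v \in S); case: (w \in S).
by rewrite !inE (negbTE iv) (negbTE iw).
Qed.

(** Edges avoiding [v] contribute equally to both cuts. An edge at [v] crosses [A] when its other
    end is in [A], and crosses [A + v] when it is not. *)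
Lemma answer_half (v : 'I_n) s A : holds n v s A -> A v = false ->
  answer (cut_oracle E (arr_set n s 0) (arr_set n s 1))
  = half_test (deg v) (count_in n (adj v) A).
Proof.
move=> sA Av; set S0 := arr_set n s 0; set S1 := arr_set n s 1.
have S1E (w : 'I_n) : (w \in S1) = A w by rewrite inE (sA w (ltn_ord w)).1.
have S0E (w : 'I_n) : (w \in S0) = A w || (w == v) by rewrite inE (sA w (ltn_ord w)).2.
have far : [set e in E | (v \notin e) && (#|e :&: S0| == 1)] =
           [set e in E | (v \notin e) && (#|e :&: S1| == 1)].
  apply/setP => e; rewrite !inE; case: (e \in E) => //=.
  case: (boolP (v \in e)) => //= ve; congr (_ == 1); apply: eq_card => w.
  rewrite !in_setI S0E S1E; case: eqP => [->|]; last by rewrite orbF.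
  by rewrite (negbTE ve).
have dE := count_inC n (adj v) A.
have c1 := card_cut_split v S1; have c0 := card_cut_split v S0.
rewrite (@card_edges_at v A) in c1; last first.
  by move=> w wv; rewrite inE cards2I // !S1E Av add0n; case: (A w).
rewrite (@card_edges_at v (fun i => ~~ A i)) in c0; last first.
  by move=> w wv; rewrite inE cards2I // !S0E (negbTE wv) eqxx orbT orbF; case: (A w).
rewrite /cut_oracle c0 c1 far -dE /half_test.
by do ![case: ifP => ?]; rewrite /=; lia.
Qed.

Lemma card_cut1 (v : 'I_n) : #|cut E [set v]| = deg v.
Proof.
rewrite -card_degree; congr #|pred_of_set _|; apply/setP => e; rewrite !inE.
case eE: (e \in E) => //=; case ve: (v \in e).
  by rewrite (setIidPr _) ?cards1 // sub1set.
rewrite (_ : e :&: _ = set0) ?cards0 //; apply/setP => w; rewrite !inE.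
by case: eqP => [->|]; rewrite ?ve ?andbF.
Qed.

Lemma adj_constant b : (forall x y : 'I_n, x != y -> adj x y = b) ->
  E = complete_graph n \/ E = empty_graph n.
Proof.
case: b => adjb; [left | right]; apply/setP => e; rewrite !inE.
  apply/idP/idP => [/simpleE->//|/cards2P[x [y [xy ->]]]].
  by rewrite -adjE adjb.
apply/negP => eE; have /eqP/cards2P[x [y [xy eq_e]]] := simpleE eE.
by move: eE; rewrite eq_e -adjE adjb.
Qed.

Lemma two_exceptional : n = 2 -> exceptional E.
Proof.
move=> n2; split; first by left.
apply: (@adj_constant (adj 0 1)) => x y.
have := ltn_ord x; have := ltn_ord y; rewrite -val_eqE /= {2 4}n2.
by case: (nat_of_ord x) (nat_of_ord y) => [|[|//]] [|[|//]] //= _ _ _; rewrite adjC.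
Qed.

Hypothesis nonexcE : ~ exceptional E.

(** If [v] is isolated, the other two vertices are adjacent, as the graph is not empty; if [v] is
    joined to both, they are not adjacent, as it is not complete. Either way they have degree 1. *)
Lemma three_degrees u v : n = 3 -> u < n -> v < n -> u != v ->
  deg v = 0 \/ deg v = 2 -> deg u = 1.
Proof.
move=> n3.
have : ~ (adj 0 1 = adj 0 2 /\ adj 0 1 = adj 1 2).
  move=> [e1 e2]; apply: nonexcE; split; first by right.
  apply: (@adj_constant (adj 0 1)) => x y.
  have := ltn_ord x; have := ltn_ord y; rewrite -val_eqE /= {2 4}n3.
  by case: (nat_of_ord x) (nat_of_ord y) => [|[|[|//]]] [|[|[|//]]] //= _ _ _; rewrite // adjC.
have := (adjxx 0, adjxx 1, adjxx 2, adjC 1 0, adjC 2 0, adjC 2 1).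
rewrite /count_in; move: adj => f H; rewrite n3.
case: u => [|[|[|//]]]; case: v => [|[|[|//]]] // ne _ _ _;
  rewrite !big_ord_recl !big_ord0 /= !H /=; move: ne;
  case: (f 0 1); case: (f 0 2); case: (f 1 2) => //=; lia.
Qed.

Lemma answer_three (v : 'I_n) : n = 3 -> deg v = 0 \/ deg v = 2 ->
  forall s u, u < n -> u != v ->
  (forall i, i < n -> (arr s 1 i != 0) = (i == u)) ->
  (forall i, i < n -> (arr s 0 i != 0) = (i == v)) ->
  answer (cut_oracle E (arr_set n s 0) (arr_set n s 1)) = deg v.
Proof.
move=> n3 dv s u un uv s1 s0; have du := three_degrees n3 un (ltn_ord v) uv dv.
have -> : arr_set n s 0 = [set v] by apply/setP => i; rewrite !inE s0.
have -> : arr_set n s 1 = [set Ordinal un] by apply/setP => i; rewrite !inE s1.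
by rewrite /cut_oracle !card_cut1 /= du; case: dv => ->.
Qed.

End Graph.

(** * The complete program and its total cost *)

Definition reconstruct : cmd :=
  Ifc (Reg rn -' #2)
    <{ rv ::= #0; While (Reg rn -' Reg rv) <{ row; rv ::= Reg rv +' #1 }> }>
    Skip.

Lemma exec_reconstruct n (E : {set {set 'I_n}}) :
  2 < n -> simple_graph E -> ~ exceptional E ->
  exists s q k t,
    [/\ exec (cut_oracle E) reconstruct (init_state n) s q t, outputs s E,
        q <= 20 * \sum_(0 <= v < n)
               minn n ((count_in n (adj E v) (fun=> true) + 1) * trunc_log 2 n),
        k <= n * (500 * (n * trunc_log 2 n) + 3) + 3 &
        t <= k * (cmd_weight reconstruct * bitlen (4 * n))].
Proof.
move=> n3 simpleE nonexcE; set L := trunc_log 2 n.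
have U1 : 1 < 4 * n by lia.
pose c v := minn n ((count_in n (adj E v) (fun=> true) + 1) * L).
(* The zero tail is what [wp_row] requires for the next row. *)
pose R v s := forall j, arr s 2 j = if j < v * n then nat_of_bool (adj E (j %/ n) (j %% n)) else 0.
pose P v s q k := [/\ reg s rn = n, reg s rv = v, R v s, q <= 20 * \sum_(0 <= i < v) c i
                    & k <= v * (500 * (n * L) + 3) + 2].
(* The failing last guard takes one step more, hence [k - 1]. *)
have : wp (cut_oracle E) (4 * n) reconstruct (fun s q k => P n s q (k - 1)) (init_state n) 0 0.
  apply: (wp_if U1) => //= n2; last by rewrite /upd /= in n2; lia.
  apply: wp_seq; apply: (wp_assign _ U1) => //.
  pose I M s q k := exists2 v, M + v = n & P v s q k.
  apply: (@wp_while _ _ _ U1 _ _ I _ n) => //.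
  - exists 0; first by rewrite addn0.
    by split=> //; move=> j; rewrite mul0n ltn0.
  - move=> M s q k [v Mv [sn sv sR leq lek]] /=; rewrite sn sv => vn'.
    have {vn'}vn : v < n by lia.
    apply: wp_seq; apply: (@wp_row n (cut_oracle E) (4 * n) n3 (leqnn _) v (adj E v)) => //.
    + exact: adjxx.
    + exact: adj_lt.
    + by move=> s1 A s1A Av; rewrite (@answer_half n E simpleE (Ordinal vn) s1 A).
    + by move=> e3 dv s1 u; apply: (@answer_three n E simpleE nonexcE (Ordinal vn)).
    + by move=> j vj; rewrite sR ltnNge vj.
    move=> s1 q1 k1 s1n s1v up1 leq1 lek1.
    apply: (wp_assign _ U1) => //=; rewrite s1v; first by lia.
    exists M.-1; first by lia.
    exists v.+1; first by lia.
    split=> //.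
    + by rewrite /= /upd /= addn1.
    + move=> j; rewrite /= up1 sR; case: (leqP (v * n) j) => /= [vj|jv]; last first.
        by rewrite (leq_trans jv) // leq_mul.
      case: (ltnP j (v.+1 * n)) => jv.
        have jE : j = v * n + (j - v * n) by rewrite subnKC.
        have jn : j - v * n < n by move: jv vj; rewrite mulSn; lia.
        rewrite {2 3}jE divnMDl ?modnMDl ?(divn_small jn) ?(modn_small jn) ?addn0; last by lia.
        by case: (adj _ _ _).
      by case aj: (adj _ _ _) => //; have := adj_lt aj; move: jv; rewrite mulSn; lia.
    + by rewrite big_nat_recr //= mulnDr; move: leq leq1; rewrite -/L -/(c v); lia.
    + by rewrite mulSn; move: lek lek1; rewrite -/L; lia.
  - move=> M s q k [v Mv [sn sv sR leq lek]] /=; rewrite sn sv => vn.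
    have {vn}vn : v = n by lia.
    by rewrite vn in sv sR leq lek; split=> //; rewrite subn1.
case=> [r|s [q [k [t [ex _ let_ [_ _ sR leq lek]]]]]].
  by rewrite /= /upd; case: eqP => // _; rewrite leq_pmull.
exists s, q, k, t; split=> //; last by move: lek; rewrite add0n -/L; lia.
move=> i j; rewrite sR.
have ij : i * n + j < n * n.
  have := ltn_ord i; have := ltn_ord j; move: (nat_of_ord i) (nat_of_ord j); nia.
rewrite ij divnMDl ?modnMDl ?divn_small ?modn_small ?addn0 ?adjE //; lia.
Qed.

(* [trunc_log 2 n] is the floor of log_2 n, hence of the order of log n for
   n >= 2. The time bound is stated for n >= 2 because log 1 = 0. *)
Theorem mainTheorem6 :
  exists (p : cmd) (c k : nat),
  forall (n : nat) (E : {set {set 'I_n}}),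
    simple_graph E -> ~ exceptional E ->
    exists (s : state) (q t : nat),
      [/\ exec (cut_oracle E) p (init_state n) s q t,
          outputs s E,
          q <= c * minn ((#|E| + n) * trunc_log 2 n) (n ^ 2) &
          2 <= n -> t <= c * (n ^ 2 * trunc_log 2 n ^ k)].
Proof.
have [W WE] : exists W, W = cmd_weight reconstruct by exists (cmd_weight reconstruct).
(* The 40 is for queries. For time, at most [510 * n ^ 2 * L] steps cost at most [W * (4 * L)] each:
   one factor [L] counts steps, the other bit lengths. *)
exists reconstruct, (40 + 2100 * W), 2 => n E simpleE nonexcE.
case: (ltnP 2 n) => [n3|n2]; last first.
  case: (eqVneq n 2) => [n2'|n2']; first by case: nonexcE; apply: two_exceptional.
  have n1 : n <= 1 by lia.
  have exs : exec (cut_oracle E) reconstruct (init_state n) (init_state n) 0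
               (1 + ecost (init_state n) (Reg rn -' #2) + 1).
    apply: exec_if_false; last exact: exec_skip.
    by rewrite /= /upd /=; lia.
  exists (init_state n), 0, (1 + ecost (init_state n) (Reg rn -' #2) + 1).
  split=> //; last by lia.
  move=> i j /=; case ijE: (_ \in E) => //; have := simpleE _ ijE.
  rewrite (_ : i = j) ?setUid ?cards1 //; apply: val_inj => /=.
  by have := ltn_ord i; have := ltn_ord j; lia.
have [s [q [k [t [ex out leq lek let_]]]]] := exec_reconstruct n3 simpleE nonexcE.
exists s, q, t; split=> //.
  set L := trunc_log 2 n in leq *.
  (* A sum of minima is at most either sum. The degrees add up to [2 * #|E|], which doubles 20 to
     40. *)
  apply: leq_trans leq _; apply: (@leq_trans (40 * minn ((#|E| + n) * L) (n ^ 2))).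
    rewrite -[40]/(20 * 2) -mulnA leq_mul2l /= minnMr leq_min; apply/andP; split.
      apply: (@leq_trans (\sum_(0 <= v < n) (count_in n (adj E v) (fun=> true) + 1) * L)).
        by apply: leq_sum => v _; apply: geq_minr.
      rewrite -big_distrl big_split /= sum_degrees // sum_nat_const_nat subn0 muln1.
      by move: #|E| => m; clear; lia.
    apply: (@leq_trans (\sum_(0 <= v < n) n)).
      by apply: leq_sum => v _; apply: geq_minl.
    by rewrite sum_nat_const_nat subn0; lia.
  by rewrite leq_mul // leq_addr.
move=> _; rewrite -WE in let_; apply: leq_trans let_ _.
set L := trunc_log 2 n in lek *.
have L0 : 0 < L by rewrite trunc_log_gt0 //; lia.
have bU : bitlen (4 * n) <= 4 * L.
  apply: leq_trans (_ : L + 3 <= _); last by lia.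
  apply: bitlen_leq; first by lia.
  by have := trunc_log_ltn n (isT : 1 < 2); rewrite -/L addn3 !expnS; lia.
have nn : n <= n ^ 2 * L by rewrite expnS expn1 -mulnA leq_pmulr // muln_gt0 L0; lia.
have kU : k <= 510 * (n ^ 2 * L).
  by apply: leq_trans lek _; move: nn; rewrite expnS expn1; lia.
apply: (@leq_trans (510 * (n ^ 2 * L) * (W * (4 * L)))).
  by rewrite !leq_mul.
by rewrite expnS expn1; lia.
Qed.
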